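(* Let $n,k\ge1$ be integers and $\mathbb{Y}$ a (potentially infinite) alphabet. Then $$\mathfrak{H}_n^k(\mathbb{Y})=\frac{(-1)^{\frac{kn(n-1)}{2}}}{n!}\binom{kn}{k,\dots,k}P^{(k)}_{n^{k(n-1)}}(\mathbb{Y}).$$
   Context: $\binom{kn}{k,\dots,k}=\frac{(kn)!}{(k!)^n}$. $n^{k(n-1)}$ is the rectangular partition with $k(n-1)$ parts all equal to $n$ (empty if $n=1$). Jack polynomials: let $\Psi_\lambda$ be the products of power sums and $\langle\Psi_\lambda,\Psi_\mu\rangle_\alpha=\delta_{\lambda\mu}z_\lambda\alpha^{\ell(\lambda)}$, where $z_\lambda=\prod_i i^{m_i(\lambda)}m_i(\lambda)!$, $m_i(\lambda)$ is the multiplicity of $i$ in $\lambda$ and $\ell(\lambda)$ the length of $\lambda$. The Jack polynomials $P_\lambda^{(\alpha)}$ are the unique symmetric functions orthogonal for $\langle\,,\rangle_\alpha$ with $P_\lambda^{(\alpha)}=m_\lambda+\sum_{\mu<\lambda}u^{(\alpha)}_{\lambda\mu}m_\mu$ ($m_\mu$ the monomial functions, $<$ the dominance order). Hyperdeterminant: for $M=(M_{i_1\cdots i_{2k}})_{0\le i_1,\dots,i_{2k}\le n-1}$, $\mathrm{Det}(M)=\frac1{n!}\sum_{\sigma_1,\dots,\sigma_{2k}}\mathrm{sign}(\sigma_1)\cdots\mathrm{sign}(\sigma_{2k})\prod_{i=0}^{n-1}M_{\sigma_1(i)\cdots\sigma_{2k}(i)}$, the sum being over $2k$-tuples of permutations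 of $\{0,\dots,n-1\}$. Hankel hyperdeterminant: $\mathfrak{H}^k_n(\mathbb{Y})=\mathrm{Det}\left(\Lambda^{i_1+\cdots+i_{2k}}(\mathbb{Y})\right)_{0\le i_1,\dots,i_{2k}\le n-1}$, where $\Lambda^m$ is the $m$-th elementary symmetric function ($\Lambda^0=1$). *)

(* Defs.v *)
From HB Require Import structures.
From mathcomp Require Import all_boot all_order all_algebra perm finmap.
From mathcomp Require Import monalg.
From mathcomp Require Import boolp classical_sets functions cardinality fsbigop.

Set Implicit Arguments.
Unset Strict Implicit.
Unset Printing Implicit Defensive.

Import GRing.Theory Num.Theory.

Local Open Scope classical_set_scope.
Local Open Scope ring_scope.

(* Formal power series over R in commuting variables indexed by an arbitrary
   (finite or infinite) type Y.  An alphabet is represented by the type of its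
   letters, and a symmetric function of the alphabet is such a series. *)
Record series (Y : choiceType) (R : Type) :=
  Series { scoef :> {cmonom Y} -> R }.

HB.instance Definition _ (Y : choiceType) (R : Type) :=
  gen_eqMixin (series Y R).
HB.instance Definition _ (Y : choiceType) (R : Type) :=
  gen_choiceMixin (series Y R).

Section SeriesRing.
Context (Y : choiceType) (R : comNzRingType).
Implicit Types (f g h : series Y R) (u d : {cmonom Y}).

Lemma seriesP f g : (forall u, f u = g u) -> f = g.
Proof. by case: f g => [f] [g] /= e; congr Series; apply/funext. Qed.

Definition series_zero : series Y R := Series (fun=> 0).
Definition series_opp f := Series (fun u => - f u).
Definition series_add f g := Series (fun u => f u + g u).
Definition series_one : series Y R := Series (fun u => (u == mone)%:R).
Definition series_mul f g := Series (fun u =>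
  \sum_(p \in [set p : {cmonom Y} * {cmonom Y} | mmul p.1 p.2 = u])
     f p.1 * g p.2).
Definition series_scale (a : R) f := Series (fun u => a * f u).

Lemma series_addA : associative series_add.
Proof. by move=> f g h; apply/seriesP => u /=; rewrite addrA. Qed.
Lemma series_addC : commutative series_add.
Proof. by move=> f g; apply/seriesP => u /=; rewrite addrC. Qed.
Lemma series_add0 : left_id series_zero series_add.
Proof. by move=> f; apply/seriesP => u /=; rewrite add0r. Qed.
Lemma series_addN : left_inverse series_zero series_opp series_add.
Proof. by move=> f; apply/seriesP => u /=; rewrite addNr. Qed.

HB.instance Definition _ := GRing.isZmodule.Build (series Y R)
  series_addA series_addC series_add0 series_addN.

Lemma finite_divisors u :
  finite_set [set d : {cmonom Y} | exists e, mmul d e = u].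
Proof.
pose mk (x : {ffun finsupp u -> 'I_(mdeg u).+1}) : {cmonom Y} :=
  [cmonom val (x i) | i : finsupp u]%M.
pose s := [seq mk x | x : {ffun finsupp u -> 'I_(mdeg u).+1}].
apply: (@sub_finite_set _ _ [set` s]); last exact: finite_seq.
move=> d [e de] /=.
have led i : (d i <= u i)%N by rewrite -de cmM leq_addr.
have leu i : (u i <= mdeg u)%N.
  case: (mdomP u i) => // iu.
  by rewrite mdegE (big_fsetD1 i) //= leq_addr.
apply/mapP; exists [ffun i : finsupp u => inord (d (val i))];
  first by rewrite mem_enum.
apply/eqP/cmP => i; rewrite cmE.
have [iu|niu] := boolP (i \in finsupp u).
  by rewrite fsfun_ffun insubT /= ffunE inordK // ltnS (leq_trans (led i)).
rewrite fsfun_ffun insubF ?(negbTE niu) //.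
by apply/eqP; rewrite -leqn0 (leq_trans (led i)) // leqn0 cmE_eq0.
Qed.

Definition divisors u : {fset {cmonom Y}} :=
  fset_set [set d : {cmonom Y} | exists e, mmul d e = u].

Lemma divisorsP d u : reflect (exists e, mmul d e = u) (d \in divisors u).
Proof.
rewrite /divisors in_fset_set; last exact: finite_divisors.
by apply: (iffP idP) => [/set_mem|/mem_set].
Qed.

Lemma divisors_refl u : u \in divisors u.
Proof. by apply/divisorsP; exists mone; rewrite mulm1. Qed.

Lemma divisors_trans d u v :
  d \in divisors u -> u \in divisors v -> d \in divisors v.
Proof.
move=> /divisorsP[e <-] /divisorsP[e' <-]; apply/divisorsP.
by exists (mmul e e'); rewrite mulmA.
Qed.


Lemma series_mulE f g (f' g' : {malg R[{cmonom Y}]}) u :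
    {in divisors u, forall d, f'@_d = f d} ->
    {in divisors u, forall d, g'@_d = g d} ->
  series_mul f g u = (f' * g')@_u.
Proof.
move=> ef eg.
pose D := (msupp f' `|` msupp g' `|` divisors u)%fset.
have sf : (msupp f' `<=` D)%fset.
  by apply/fsubsetP => d hd; rewrite !inE hd.
have sg : (msupp g' `<=` D)%fset.
  by apply/fsubsetP => d hd; rewrite !inE hd orbT.
rewrite (mcoeffMlw _ sf sg) /=.
pose F (p : {cmonom Y} * {cmonom Y}) :=
  (f'@_p.1 * g'@_p.2) *+ (mmul p.1 p.2 == u).
rewrite -(@big_allpairs _ _ _ _ _ _ _ F).
transitivity (\sum_(p \in [set p | mmul p.1 p.2 = u]) F p).
  apply: eq_fsbigr => -[d e]; rewrite inE /= => de.
  rewrite /F /= de eqxx ef ?eg //; apply/divisorsP; first by exists d; rewrite mulmC.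
  by exists e.
apply: fsbig_fwiden => /=.
- move=> [d e] /= de; apply/allpairsP; exists (d, e); split=> //=.
    by rewrite !inE; apply/orP; right; apply/divisorsP; exists e.
  rewrite !inE; apply/orP; right; apply/divisorsP; exists d.
  by rewrite mulmC.
- by apply: allpairs_uniq; rewrite ?fset_uniq // => -[? ?] [? ?].
- by move=> [d e] [_ /= /eqP/negbTE de]; rewrite /F /= de.
Qed.

Definition truncate u f : {malg R[{cmonom Y}]} :=
  [malg d in divisors u => f d].

Lemma truncateE u f : {in divisors u, forall d, (truncate u f)@_d = f d}.
Proof. by move=> d hd; rewrite /truncate /mcoeff fsfun_fun hd. Qed.

Lemma truncate_sub u v f : u \in divisors v ->
  {in divisors u, forall d, (truncate v f)@_d = f d}.
Proof. by move=> uv d du; rewrite truncateE // (divisors_trans du). Qed.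

Lemma series_mulA : associative series_mul.
Proof.
move=> f g h; apply/seriesP => u.
pose tf := truncate u f; pose tg := truncate u g; pose th := truncate u h.
have egh : {in divisors u, forall d, (tg * th)@_d = series_mul g h d}.
  by move=> d du; apply/esym/series_mulE; apply: truncate_sub.
have efg : {in divisors u, forall d, (tf * tg)@_d = series_mul f g d}.
  by move=> d du; apply/esym/series_mulE; apply: truncate_sub.
apply: etrans (series_mulE (@truncateE u f) egh) _.
apply: etrans (esym (series_mulE efg (@truncateE u h))).
by rewrite mulrA.
Qed.

Lemma series_mulC : commutative series_mul.
Proof.
move=> f g; apply/seriesP => u.
rewrite (series_mulE (truncateE f) (truncateE g)).
by rewrite (series_mulE (truncateE g) (truncateE f)) mulrC.
Qed.

Lemma series_mul1 : left_id series_one series_mul.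
Proof.
move=> f; apply/seriesP => u.
rewrite (@series_mulE _ _ 1 _ _ _ (truncateE f)) ?mul1r ?truncateE //.
  exact: divisors_refl.
by move=> d _; rewrite mcoeff1.
Qed.

Lemma series_mulDl : left_distributive series_mul +%R.
Proof.
move=> f g h; apply/seriesP => u.
have efg : {in divisors u, forall d,
    (truncate u f + truncate u g)@_d = (f + g) d}.
  by move=> d du; rewrite mcoeffD !truncateE.
apply: etrans (series_mulE efg (@truncateE u h)) _.
rewrite mulrDl mcoeffD; apply/esym.
by congr (_ + _); apply: series_mulE; apply: truncateE.
Qed.

Lemma series_one_neq0 : series_one != 0.
Proof.
apply/eqP => /(congr1 (fun f : series Y R => f mone)) /=.
by rewrite eqxx => /eqP; rewrite oner_eq0.
Qed.

HB.instance Definition _ := GRing.Zmodule_isComNzRing.Build (series Y R)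
  series_mulA series_mulC series_mul1 series_mulDl series_one_neq0.

Lemma series_scaleA a b f :
  series_scale a (series_scale b f) = series_scale (a * b) f.
Proof. by apply/seriesP => u /=; rewrite mulrA. Qed.
Lemma series_scale1 : left_id 1 series_scale.
Proof. by move=> f; apply/seriesP => u /=; rewrite mul1r. Qed.
Lemma series_scaleDr : right_distributive series_scale +%R.
Proof. by move=> a f g; apply/seriesP => u /=; rewrite mulrDr. Qed.
Lemma series_scaleDl f : {morph series_scale^~ f : a b / a + b}.
Proof. by move=> a b; apply/seriesP => u /=; rewrite mulrDl. Qed.

HB.instance Definition _ := GRing.Zmodule_isLmodule.Build R (series Y R)
  series_scaleA series_scale1 series_scaleDr series_scaleDl.

Lemma series_scaleAl (a : R) f g : a *: (f * g) = (a *: f) * g.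
Proof.
apply/seriesP => u; change (a * series_mul f g u = series_mul (a *: f) g u).
rewrite (series_mulE (truncateE f) (truncateE g)).
rewrite (@series_mulE _ _ (a *: truncate u f) _ _ _ (truncateE g)).
  by rewrite -scalerAl mcoeffZ.
by move=> d du; rewrite mcoeffZ truncateE.
Qed.

HB.instance Definition _ :=
  GRing.Lmodule_isLalgebra.Build R (series Y R) series_scaleAl.
HB.instance Definition _ := GRing.Lalgebra_isComAlgebra.Build R (series Y R).

End SeriesRing.

Definition is_part (s : seq nat) := sorted geq s && (0%N \notin s).

Record intpart := IntPart { parts :> seq nat; _ : is_part parts }.

HB.instance Definition _ := [isSub for parts].
HB.instance Definition _ := [Choice of intpart by <:].

Lemma is_part_rect (n k : nat) : is_part (nseq (k * (n - 1))%N n).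
Proof.
apply/andP; split.
  by case: (k * (n - 1))%N => //= m; elim: m => //= m ->; rewrite leqnn.
by case: n => [|n]; rewrite ?muln0 // mem_nseq andbF.
Qed.

Definition rect_part (n k : nat) : intpart := IntPart (is_part_rect n k).

Definition dominates (la mu : intpart) : Prop :=
  sumn mu = sumn la /\
  forall j, (sumn (take j mu) <= sumn (take j la))%N.

Definition dom_lt (mu la : intpart) : Prop := dominates la mu /\ mu <> la.

Definition zpart (la : intpart) : nat :=
  (\prod_(i <- undup la) (i ^ count_mem i la * (count_mem i la)`!))%N.

Section SymmetricFunctions.
Context (R : comNzRingType) (Y : choiceType).
Implicit Types (m : nat) (la : intpart).

(* Lambda^m(Y): the sum of the squarefree monomials of degree m. *)
Definition elementary m : series Y R := Series (fun u =>
  ((mdeg u == m) && all (fun y => u y == 1%N) (finsupp u))%:R).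

(* Sum of y^m over the letters y, for m > 0 (only these values occur below). *)
Definition power_sum m : series Y R := Series (fun u =>
  `[< exists y : Y, u = expcmn (ucm y) m >]%:R).

(* Sum of the distinct monomials whose exponents, in decreasing order,
   form la. *)
Definition monomial la : series Y R := Series (fun u =>
  (sort geq [seq u y | y <- finsupp u] == la)%:R).

Definition Psi la : series Y R := \prod_(i <- la) power_sum i.

End SymmetricFunctions.

(* The algebra of symmetric functions over a field of characteristic 0 has
   the products of power sums as a linear basis: an abstract symmetric function
   f is given by its coordinates f@_la in this basis, and sym_eval Y f is the
   series f(Y). *)
Definition symfun (F : numFieldType) := {malg F[intpart]}.

Section Jack.
Context (F : numFieldType).
Implicit Types (f g : symfun F) (la mu : intpart).

Definition sym_eval (Y : choiceType) f : series Y F :=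
  \sum_(la <- msupp f) f@_la *: Psi F Y la.

Definition jack_dot (alpha : F) f g : F :=
  \sum_(la <- msupp f) f@_la * g@_la * ((zpart la)%:R * alpha ^+ size la).

(* The unitriangularity is an identity between symmetric functions: it is
   stated on the infinite alphabet of letters indexed by nat, on which the
   monomial functions are linearly independent. *)
Definition unitriangular la f : Prop :=
  exists2 u : {malg F[intpart]},
    forall mu, mu \in msupp u -> dom_lt mu la &
    sym_eval nat f =
      monomial F nat la + \sum_(mu <- msupp u) u@_mu *: monomial F nat mu.

Definition is_jack (alpha : F) (P : intpart -> symfun F) : Prop :=
  (forall la mu, la <> mu -> jack_dot alpha (P la) (P mu) = 0) /\
  (forall la, unitriangular la (P la)).

End Jack.

Definition hyperdet (F : fieldType) (A : comAlgType F) (n k : nat)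
    (M : {ffun 'I_(2 * k) -> 'I_n} -> A) : A :=
  (n`!%:R^-1 : F) *:
  \sum_(s : {ffun 'I_(2 * k) -> 'S_n})
    (\prod_j (-1) ^+ s j) * \prod_i M [ffun j => s j i].

Definition hankel_hyperdet (F : fieldType) (Y : choiceType) (n k : nat) :
    series Y F :=
  hyperdet (fun i : {ffun 'I_(2 * k) -> 'I_n} =>
    elementary F Y (\sum_j i j)%N).

(* Main.v *)
From HB Require Import structures.
From mathcomp Require Import all_boot all_order all_algebra perm fraction mpoly.
From mathcomp Require Import finmap monalg boolp.
From mathcomp Require Import ring zify.
Require Import Defs.

(** Write [m = k (n - 1)] and let [x_1], ..., [x_n] be auxiliary letters.
    Expanding the hyperdeterminant over tuples of permutations shows that
    [n! H] is the image of the power [V(x) ^ (2 k)] of the Vandermonde product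
    under the linear map [x ^ a |-> \prod_i e_(a_i)].  Call [la] the rectangle
    with [m] parts equal to [n].  The theorem follows from three facts.

    - Triangularity.  The [e_r] are sums of squarefree monomials, so that all
      the exponents of [H], which is homogeneous of degree [m n], are at most
      [n] ([hankel_part_coef_neq0]).

    - Orthogonality.  The products [\prod_i e_(a_i)] have the generating
      function [exp (\sum_r (-1) ^ (r - 1) p_r p_r(x) / r)], which reproduces
      the scalar product: pairing with it substitutes
      [(-1) ^ (r - 1) k p_r(x)] for [p_r] ([jack_dot_esf_prod]).  Under this
      substitution [e_r] becomes the complete function [g_r] of the letters
      [x_i] repeated [k] times.  After reversal of the permutations, [(H, f)]
      is, up to [n!], the coefficient of [\prod_i x_i ^ (2 m)] in
      [V ^ (2 k) f(g)] ([jack_dot_hankel]).  Divided differences show that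
      [V ^ (2 k) g_r] lies in the ideal of the [x_i ^ (r + m)]
      ([node_powers_complete]), so that [(H, e_r f) = 0] for all [f] as soon as
      [r > m].  The ideal of the [e_r] with [r > m] consists of the functions
      that vanish on [m] letters, by the fundamental theorem on symmetric
      polynomials; it contains [P_mu] whenever [mu] has more than [m] parts,
      because of the unitriangularity ([jack_dot_hankel_vanish],
      [unitriangular_vanish]).

    - Normalization.  Only the exponents [a = (m, ..., m)] contribute to the
      coefficient of the monomial function of index [la], and the coefficient of
      [x ^ a] in [V ^ (2 k)] is, up to sign, the constant term of
      [\prod_(i != j) (1 - x_i / x_j) ^ k], which is Dyson's multinomial
      coefficient ([dyson_coef], by Good's argument).

    Expand now [H = \sum_mu a_mu P_mu].  By triangularity [a_mu = 0] if [mu] is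
    of another size than [la] or has a part larger than [n].  By orthogonality
    [a_mu = 0] if [mu] has more than [m] parts.  Only [mu = la] is left, and
    [a_la] is the coefficient found in the last step
    ([jack_characterization], [hankel_jack]).

    The expansion is possible because unitriangularity and the linear
    independence of the products of power sums allow the elimination of
    coefficients along the dominance order ([jack_span]).

    Symmetric functions in abstract form are given the algebra structure for
    which they are polynomials in the power sums, and every sequence defined by
    Newton's recursion is treated at once ([newton]). *)

Set Implicit Arguments.
Unset Strict Implicit.
Unset Printing Implicit Defensive.

Import GRing.Theory Num.Theory.
Local Open Scope ring_scope.

(** * Coefficients of formal series *)

Lemma expcmnE (Y : choiceType) (v : {cmonom Y}) r z :
  expcmn v r z = (r * v z)%N.
Proof.
rewrite /expcmn; case: r => [|r]; first by rewrite onecmE.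
elim: r => [|r IH]; first by rewrite mul1n.
by rewrite iteropS iterS mulcmE mulSn -IH iteropS.
Qed.

Lemma mpowE (Y : choiceType) (y z : Y) r :
  expcmn (ucm y) r z = ((y == z) * r)%N.
Proof. by rewrite expcmnE ucmE mulnC. Qed.

Section Coefficients.
Context (Y : choiceType) (R : comNzRingType).
Implicit Types (f g : series Y R) (u v w d : {cmonom Y}).

Lemma series_coefD f g u : (f + g) u = f u + g u. Proof. by []. Qed.
Lemma series_coefN f u : (- f) u = - f u. Proof. by []. Qed.
Lemma series_coefZ a f u : (a *: f) u = a * f u. Proof. by []. Qed.
Lemma series_coef1 u : (1 : series Y R) u = (u == mone)%:R. Proof. by []. Qed.

Lemma series_coef_sum I (s : seq I) (P : pred I) (h : I -> series Y R) u :
  (\sum_(i <- s | P i) h i) u = \sum_(i <- s | P i) h i u.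
Proof. by elim/big_rec2: _ => // i x y _ <-. Qed.

Lemma mulcm_div u d : d \in divisors u -> mmul d (divcm u d) = u.
Proof.
by case/divisorsP=> e <-; apply/eqP/cmP=> i; rewrite !(cmM, divcmE) addKn.
Qed.

Lemma divcmK d e : divcm (mmul d e) d = e.
Proof. by apply/eqP/cmP=> i; rewrite divcmE cmM addKn. Qed.

Lemma mem_divisors d u : (d \in divisors u) = [forall y : finsupp d, (d (val y) <= u (val y))%N] :> bool.
Proof.
apply/idP/forallP=> [/mulcm_div <- y|le]; first by rewrite cmM leq_addr.
apply/divisorsP; exists (divcm u d); apply/eqP/cmP=> y; rewrite cmM divcmE.
case: (mdomP d y) => [yd|yd]; last by rewrite add0n subn0.
by rewrite subnKC //; have := le [` yd]%fset.
Qed.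

Lemma divisorsE d u : (forall y, d y <= u y)%N -> d \in divisors u.
Proof. by move=> le; rewrite mem_divisors; apply/forallP. Qed.

Lemma series_coefM f g u :
  (f * g) u = \sum_(d <- divisors u) f d * g (divcm u d).
Proof.
rewrite (_ : (f * g) u = series_mul f g u) //.
rewrite (series_mulE (truncateE f) (truncateE g)).
have sub (h : series Y R) : (msupp (truncate u h) `<=` divisors u)%fset.
  apply/fsubsetP=> d; rewrite -mcoeff_neq0 /truncate /mcoeff fsfun_fun.
  by case: ifP => //; rewrite eqxx.
rewrite (mcoeffMlw _ (sub f) (sub g)); apply: eq_big_seq => d du.
have eu := mulcm_div du; have cu : divcm u d \in divisors u.
  by apply/divisorsP; exists d; rewrite mulmC.
rewrite (big_fsetD1 (divcm u d)) //= eu eqxx mulr1n !truncateE //.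
rewrite big_seq big1 ?addr0 // => e; rewrite !inE => /andP[ne eu'].
case: eqP => // de; rewrite -de divcmK in ne.
by rewrite eqxx in ne.
Qed.

Lemma series_coefM_neq0 f g u : (f * g) u != 0 ->
  exists v w, [/\ mmul v w = u, f v != 0 & g w != 0].
Proof.
rewrite series_coefM => h.
have [/hasP[d du /andP[fd gd]]|/hasPn no] := boolP
  (has (fun d => (f d != 0) && (g (divcm u d) != 0)) (divisors u)).
  by exists d, (divcm u d); rewrite mulcm_div.
move: h; rewrite big_seq big1 ?eqxx // => d /no.
by rewrite negb_and !negbK => /orP[]/eqP->; rewrite ?mul0r ?mulr0.
Qed.

Definition xmon v : series Y R := Series (fun u => (u == v)%:R).

Lemma coef_xmonM v f u :
  (xmon v * f) u = if v \in divisors u then f (divcm u v) else 0.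
Proof.
rewrite series_coefM; case: ifP => vu.
  rewrite (big_fsetD1 v) //= eqxx mul1r big_seq big1 ?addr0 // => d.
  by rewrite !inE => /andP[/negbTE-> _]; rewrite mul0r.
rewrite big_seq big1 // => d du /=; case: eqP => [dv|]; last by rewrite mul0r.
by rewrite -dv du in vu.
Qed.

Lemma coef_xmonMl v f w : (xmon v * f) (mmul v w) = f w.
Proof.
by rewrite coef_xmonM divcmK ifT //; apply/divisorsP; exists w.
Qed.

Lemma xmonM v w : xmon v * xmon w = xmon (mmul v w).
Proof.
apply/seriesP=> u; rewrite coef_xmonM /=; case: ifP => [vu|/negP vu].
  rewrite (_ : (divcm u v == w) = (u == mmul v w)) //.
  by apply/eqP/eqP=> [<-|->]; rewrite ?divcmK ?mulcm_div.
by case: eqP => // uvw; case: vu; apply/divisorsP; exists w.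
Qed.

Lemma xmon1 : xmon mone = 1.
Proof. exact/seriesP. Qed.

Lemma xmonX v r : xmon v ^+ r = xmon (expcmn v r).
Proof.
elim: r => [|r IH]; first by rewrite expr0 -xmon1.
rewrite exprS IH xmonM; congr xmon; apply/eqP/cmP=> z.
by rewrite cmM !expcmnE mulSn.
Qed.

(** Over an infinite alphabet the sum of the powers is an infinite sum, but
    only the letters of the monomial [u] can contribute to its coefficient. *)
Lemma coef_power_sumM r f u : (0 < r)%N ->
  (power_sum R Y r * f) u =
    \sum_(y <- finsupp u | (r <= u y)%N) f (divcm u (expcmn (ucm y) r)).
Proof.
move=> r0; rewrite series_coefM.
transitivity (\sum_(d <- divisors u) \sum_(y <- finsupp u)
   (d == expcmn (ucm y) r)%:R * f (divcm u d)).
  apply: eq_big_seq => d du; rewrite -mulr_suml; congr (_ * _) => /=.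
  case: asboolP => [[y dy]|no].
    have yu : y \in finsupp u.
      rewrite -cmE_neq0 -(mulcm_div du) cmM dy mpowE eqxx mul1n.
      by rewrite -lt0n ltn_addr.
    rewrite (big_fsetD1 y) //= dy eqxx big_seq big1 ?addr0 // => z.
    rewrite !inE => /andP[zy _]; case: eqP => // /eqP/cmP/(_ y).
    by rewrite !mpowE eqxx (negbTE zy) mul1n => r00; rewrite r00 in r0.
  by rewrite big1 // => y _; case: eqP => // dy; case: no; exists y.
rewrite exchange_big /= [RHS]big_mkcond; apply: eq_big_seq => y yu /=.
case: ifP => ry.
  have yd : expcmn (ucm y) r \in divisors u.
    by apply: divisorsE => z; rewrite mpowE; case: eqP => // <-; rewrite mul1n.
  rewrite (big_fsetD1 _ yd) /= eqxx mul1r big_seq big1 ?addr0 // => d.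
  by rewrite !inE => /andP[/negbTE-> _]; rewrite mul0r.
rewrite big_seq big1 // => d du; case: eqP => [dy|]; last by rewrite mul0r.
by move: ry; rewrite -(mulcm_div du) cmM dy mpowE eqxx mul1n leq_addr.
Qed.

End Coefficients.

(** * Newton's recursion and the algebra of symmetric functions *)

(** The coefficients of [exp (\sum_(r > 0) p_r t ^ r / r)], characterized by
    the logarithmic derivative of this series.  Elementary functions (up to
    signs in [p]) and complete functions of any alphabet, with multiplicities,
    are of this form. *)
Definition is_newton (A : pzRingType) (p a : nat -> A) : Prop :=
  a 0%N = 1 /\
  forall r, a r.+1 *+ r.+1 = \sum_(i < r.+1) p i.+1 * a (r - i)%N.

Section Newton.
Context (F : numFieldType) (A : comAlgType F).
Implicit Types (p q a b : nat -> A).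

Lemma mulrSn_inj r : injective (fun x : A => x *+ r.+1).
Proof.
move=> x y /(congr1 (fun z => (r.+1%:R^-1 : F) *: z)).
by rewrite -!scaler_nat !scalerA mulVf ?pnatr_eq0 // !scale1r.
Qed.

Lemma newton_unique p q a b : is_newton p a -> is_newton q b ->
  (forall r, p r.+1 = q r.+1) -> a =1 b.
Proof.
move=> [a0 aS] [b0 bS] pq; elim/ltn_ind=> -[|r] IH; first by rewrite a0 b0.
apply: (@mulrSn_inj r); rewrite aS bS; apply: eq_bigr => i _.
by rewrite pq IH // ltnS leq_subr.
Qed.

Fixpoint newton_seq p r : seq A :=
  if r is r'.+1 then let s := newton_seq p r' in
    rcons s ((r'.+1%:R^-1 : F) *: \sum_(i < r'.+1) p i.+1 * s`_(r' - i))
  else [:: 1].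

Definition newton p r := (newton_seq p r)`_r.

Lemma size_newton_seq p r : size (newton_seq p r) = r.+1.
Proof. by elim: r => //= r IH; rewrite size_rcons IH. Qed.

Lemma nth_newton_seq p r i : (i <= r)%N -> (newton_seq p r)`_i = newton p i.
Proof.
elim: r => [|r IH]; first by case: i.
rewrite leq_eqVlt => /orP[/eqP-> //|]; rewrite ltnS => ir.
by rewrite /= nth_rcons size_newton_seq ltnS ir IH.
Qed.

Lemma newtonP p : is_newton p (newton p).
Proof.
split=> // r; rewrite {1}/newton /= nth_rcons size_newton_seq ltnn eqxx.
rewrite -scaler_nat scalerA divff ?pnatr_eq0 // scale1r.
by apply: eq_bigr => i _; rewrite nth_newton_seq // leq_subr.
Qed.

Lemma newton_eq p a : is_newton p a -> a =1 newton p.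
Proof. by move=> h; apply: newton_unique h (newtonP p) _. Qed.

Lemma eq_newton p q : (forall r, p r.+1 = q r.+1) -> newton p =1 newton q.
Proof. by move=> h; apply: newton_unique (newtonP p) (newtonP q) h. Qed.

(** The recursion read backwards: the power sums are polynomials in the
    sequence that they define. *)
Lemma newton_inv p r : p r.+1 = (r.+1%:R : F) *: newton p r.+1
  + (-1 : F) *: \sum_(i < r) p i.+1 * newton p (r - i)%N.
Proof.
have [p0 pS] := newtonP p.
by rewrite scaler_nat pS big_ord_recr /= subnn p0 mulr1 scaleN1r addrAC subrr add0r.
Qed.

Lemma newton0 : newton (fun=> 0) =1 fun r => (r == 0)%:R.
Proof.
move=> r; apply/esym/(newton_eq (a := fun r => (r == 0%N)%:R)).
split=> // {}r; rewrite mul0rn big1 // => i _; exact: mul0r.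
Qed.

(** The substitution of [x t] for [t] in [exp (\sum_r q_r t ^ r / r)]. *)
Lemma newton_scale x q r :
  newton (fun i => x ^+ i * q i) r = x ^+ r * newton q r.
Proof.
apply/esym/(newton_eq (a := fun r => x ^+ r * newton q r)).
have [q0 qS] := newtonP q; split=> [|{}r]; first by rewrite expr0 q0 mulr1.
rewrite -mulrnAr qS mulr_sumr; apply: eq_bigr => i _.
have -> : x ^+ r.+1 = x ^+ i.+1 * x ^+ (r - i)%N.
  by rewrite -exprD addSn subnKC // -ltnS.
by ring.
Qed.

(** Removing one copy of the letter [x] multiplies the generating function of
    the sequence by [1 - x t]. *)
Lemma newton_remove p x r :
  newton p r.+1 - x * newton p r = newton (fun i => p i - x ^+ i) r.+1.
Proof.
pose sh r := if r is r'.+1 then newton p r' else 0.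
apply: (newton_eq (a := fun r => newton p r - x * sh r)).
have [q0 qS] := newtonP p; split=> [|{}r] /=; first by rewrite q0 mulr0 subr0.
rewrite (eq_bigr (fun i : 'I_r.+1 => p i.+1 * newton p (r - i)
    - x * (p i.+1 * sh (r - i)%N)
    - x ^+ i.+1 * (newton p (r - i) - x * sh (r - i)%N))); last first.
  by move=> i _; ring.
rewrite !sumrB -mulr_sumr -qS.
have -> : \sum_(i < r.+1) p i.+1 * sh (r - i)%N = newton p r *+ r.
  case: r => [|r]; first by rewrite big_ord1 mulr0.
  rewrite big_ord_recr /= subnn mulr0 addr0 qS; apply: eq_bigr => i _.
  by rewrite subSn // -ltnS.
have -> : \sum_(i < r.+1) x ^+ i.+1 * (newton p (r - i) - x * sh (r - i)%N)
    = x * newton p r.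
  elim: r => [|r IH]; first by rewrite big_ord1 /= mulr0 subr0.
  rewrite big_ord_recl /= (eq_bigr (fun i : 'I_r.+1 =>
    x * (x ^+ i.+1 * (newton p (r - i) - x * sh (r - i)%N)))); last first.
    by move=> i _; rewrite /bump /= add1n subSS mulrA -exprS.
  by rewrite -mulr_sumr IH subn0 /=; ring.
by rewrite mulrnBl -mulrnAr (mulrSr (newton p r)) mulrDr opprD addrA.
Qed.

End Newton.

(** The recursion only uses the structure of algebra. *)
Lemma newton_morph (F : numFieldType) (A B : comAlgType F)
    (f : {rmorphism A -> B}) (p : nat -> A) (q : nat -> B) :
    (forall r, f (p r.+1) = q r.+1) ->
  forall r, f (newton p r) = newton q r.
Proof.
move=> fp r; apply: (newton_eq (a := fun r => f (newton p r))).
have [p0 pS] := newtonP p; split=> [|{}r]; first by rewrite p0 rmorph1.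
rewrite -rmorphMn /= pS rmorph_sum; apply: eq_bigr => i _.
by rewrite rmorphM fp.
Qed.

Lemma is_part_sort (s : seq nat) : 0%N \notin s -> is_part (sort geq s).
Proof.
move=> s0; rewrite /is_part sort_sorted; last by move=> x y; apply: leq_total.
by rewrite mem_sort.
Qed.

Lemma geq_trans : transitive geq.
Proof. by move=> x y z yx xz; apply: leq_trans xz yx. Qed.

Lemma geq_anti : antisymmetric geq.
Proof. by move=> x y h; apply/eqP; rewrite eqn_leq andbC. Qed.

Lemma geq_total : total geq.
Proof. by move=> x y; apply: leq_total. Qed.

Lemma parts_sorted (la : intpart) : sorted geq la.
Proof. by case: la => s /= /andP[]. Qed.

Lemma parts_neq0 (la : intpart) : 0%N \notin (la : seq nat).
Proof. by case: la => s /= /andP[]. Qed.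

Lemma parts_gt0 (la : intpart) i : i \in (la : seq nat) -> (0 < i)%N.
Proof. by case: i => // h; have := parts_neq0 la; rewrite h. Qed.

Lemma intpartP (la mu : intpart) : perm_eq la mu -> la = mu.
Proof.
move=> h; apply: val_inj.
exact: (sorted_eq geq_trans geq_anti (parts_sorted la) (parts_sorted mu)).
Qed.

Definition part_of (s : seq nat) (s0 : 0%N \notin s) : intpart :=
  IntPart (is_part_sort s0).

Lemma part_ofP s s0 : perm_eq (@part_of s s0) s.
Proof. by rewrite perm_sort. Qed.

Lemma cat_neq0 (la mu : intpart) : 0%N \notin (la ++ mu).
Proof. by rewrite mem_cat negb_or !parts_neq0. Qed.

Definition part1 : intpart := @IntPart [::] isT.

(** The union of two partitions, that is the product of their power sum
    functions; it makes the coordinates in the basis of the power sums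
    into a monoid algebra. *)
Definition partM (la mu : intpart) : intpart := part_of (cat_neq0 la mu).

Lemma partMP (la mu : intpart) : perm_eq (partM la mu) (la ++ mu).
Proof. exact: part_ofP. Qed.

Lemma partMA : associative partM.
Proof.
move=> la mu nu; apply: intpartP.
rewrite (permPl (partMP _ _)) perm_sym (permPl (partMP _ _)) perm_sym.
have /permPr-> : perm_eq (partM la mu ++ nu) ((la ++ mu) ++ nu).
  by rewrite perm_cat2r partMP.
by rewrite -catA perm_cat2l partMP.
Qed.

Lemma partMC : commutative partM.
Proof.
move=> la mu; apply: intpartP; rewrite (permPl (partMP _ _)) perm_sym.
by rewrite (permPl (partMP _ _)) perm_catC.
Qed.

Lemma part1M : left_id part1 partM.
Proof. by move=> la; apply: intpartP; rewrite (permPl (partMP _ _)). Qed.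

Lemma partM1 : right_id part1 partM.
Proof. by move=> la; rewrite partMC part1M. Qed.

Lemma partM_eq1 (la mu : intpart) :
  partM la mu = part1 -> la = part1 /\ mu = part1.
Proof.
move=> h; have := perm_size (partMP la mu); rewrite h size_cat /= => /esym/eqP.
by rewrite addn_eq0 !size_eq0 => /andP[/eqP la0 /eqP mu0]; split; apply: val_inj.
Qed.

HB.instance Definition _ := Choice_isMonomialDef.Build intpart
  partMA part1M partM1 partM_eq1.
HB.instance Definition _ := MonomialDef_isConomialDef.Build intpart partMC.

HB.instance Definition _ (F : numFieldType) :=
  GRing.ComAlgebra.copy (symfun F) {malg F[intpart]}.

Lemma part_single_proof r : is_part [:: r.+1]. Proof. by []. Qed.
Definition part_single r : intpart := IntPart (part_single_proof r).

Section Evaluation.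
Context (F : numFieldType) (A : comAlgType F) (p : nat -> A).
Implicit Types (f g : symfun F).

Definition psi (la : intpart) : A := \prod_(i <- la) p i.

Lemma psi_mmorphism : mmorphism psi.
Proof.
split=> [la mu|]; last by rewrite /psi big_nil.
by rewrite /psi (perm_big _ (partMP la mu)) big_cat.
Qed.

HB.instance Definition _ := isMultiplicative.Build intpart A psi psi_mmorphism.

(** The algebra morphism that sends the power sums to the sequence [p]. *)
Definition ev (f : symfun F) : A := mmap (in_alg A) psi f.

HB.instance Definition _ := GRing.RMorphism.copy ev (mmap (in_alg A) psi).

Lemma evE f : ev f = \sum_(la <- msupp f) mcoeff la f *: psi la.
Proof. by apply: eq_bigr => la _; rewrite mulr_algl. Qed.

Lemma ev_scalable : scalable ev.
Proof. by move=> a f; rewrite /ev mmapZ mulr_algl. Qed.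

Lemma ev0 : ev 0 = 0. Proof. exact: raddf0. Qed.
Lemma ev1 : ev 1 = 1. Proof. exact: rmorph1. Qed.
Lemma evD f g : ev (f + g) = ev f + ev g. Proof. exact: raddfD. Qed.
Lemma evM f g : ev (f * g) = ev f * ev g. Proof. exact: rmorphM. Qed.
Lemma evZ a f : ev (a *: f) = a *: ev f. Proof. exact: ev_scalable. Qed.

Lemma ev_sum I (s : seq I) (P : pred I) (h : I -> symfun F) :
  ev (\sum_(i <- s | P i) h i) = \sum_(i <- s | P i) ev (h i).
Proof. exact: raddf_sum. Qed.

Lemma ev_prod I (s : seq I) (P : pred I) (h : I -> symfun F) :
  ev (\prod_(i <- s | P i) h i) = \prod_(i <- s | P i) ev (h i).
Proof. exact: rmorph_prod. Qed.

Lemma ev_basis la : ev << la >> = psi la.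
Proof. by rewrite /ev mmapU mulr_algl scale1r. Qed.

End Evaluation.

(** * Elementary symmetric functions *)

Section ElementaryNewton.
Context (Y : choiceType).
Implicit Types (u v : {cmonom Y}).

Definition sqfree u := all (fun y => u y == 1%N) (finsupp u).

Lemma sqfreeP u : reflect (forall y, u y <= 1)%N (sqfree u).
Proof.
apply: (iffP allP) => [h y|h y].
  by case: (mdomP u y) => // yu; rewrite (eqP (h _ yu)).
by rewrite -cmE_neq0 -lt0n => yu; rewrite eqn_leq h.
Qed.

Lemma mdeg_divcm u d : d \in divisors u -> mdeg u = (mdeg d + mdeg (divcm u d))%N.
Proof. by move=> du; rewrite -{1}(mulcm_div du) mdegM. Qed.

Lemma mdeg_mpow (y : Y) r : mdeg (expcmn (ucm y) r) = r.
Proof.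
rewrite (mdegEw (d := [fset y]%fset)) ?big_seq_fset1 ?mpowE ?eqxx ?mul1n //.
apply/fsubsetP=> z; rewrite -cmE_neq0 mpowE.
by case: (y =P z) => [->|_]; rewrite ?mul0n ?eqxx // inE eqxx.
Qed.

Lemma mpow_div u y r : (r <= u y)%N -> expcmn (ucm y) r \in divisors u.
Proof. by move=> ru; apply: divisorsE => z; rewrite mpowE; case: eqP => [<-|]; rewrite ?mul1n. Qed.

(** For a letter [y] with [hook i u y], the monomial [u] is [y ^ i] times a
    squarefree monomial in the other letters. *)
Definition hook i u y := (u y == i) && all (fun z => (z == y) || (u z == 1%N)) (finsupp u).

Lemma hookP i u y : reflect (u y = i /\ forall z, z != y -> (u z <= 1)%N) (hook i u y).
Proof.
apply: (iffP andP) => -[ui h].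
  split=> [|z zy]; first exact/eqP.
  case: (mdomP u z) => // zu; have := allP h z zu.
  by rewrite (negbTE zy) => /eqP->.
split; first exact/eqP.
apply/allP=> z; rewrite -cmE_neq0 -lt0n; case: eqP => //= /eqP zy zu.
by rewrite eqn_leq h.
Qed.

Lemma sqfree_div_mpow u y i : (i <= u y)%N ->
  sqfree (divcm u (expcmn (ucm y) i)) = hook i u y || hook i.+1 u y.
Proof.
move=> iu; apply/sqfreeP/orP => [h|].
  have hz z : z != y -> (u z <= 1)%N.
    by move=> zy; have := h z; rewrite divcmE mpowE eq_sym (negbTE zy) mul0n subn0.
  have := h y; rewrite divcmE mpowE eqxx mul1n.
  have [ui|] := eqVneq (u y) i; first by move=> _; left; apply/hookP.
  by move=> ne le; right; apply/hookP; split => //; lia.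
case=> /hookP[uy hz] z; rewrite divcmE mpowE; case: eqP => [<-|/eqP].
- by rewrite uy; lia.
- by rewrite eq_sym => /hz; lia.
- by rewrite uy; lia.
by rewrite eq_sym => /hz; lia.
Qed.

Lemma mdeg_ge u y : (u y <= mdeg u)%N.
Proof.
case: (mdomP u y) => // yu.
by rewrite mdegE (big_fsetD1 y) //= leq_addr.
Qed.

End ElementaryNewton.

Arguments expcmn : simpl never.
Arguments elementary : simpl never.

Section Elementary.
Context (F : numFieldType) (Y : choiceType).
Implicit Types (u v : {cmonom Y}).
Local Notation el := (elementary F Y).
Local Notation ps := (power_sum F Y).

Lemma elementaryE r u : el r u = ((mdeg u == r) && sqfree u)%:R.
Proof. by []. Qed.

(** Newton's identity: for [i > 1] a monomial [y ^ i v] with [v] squarefree and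
    prime to [y] occurs in the products for [i] and [i - 1], with opposite
    signs; only the squarefree monomials survive, once for each letter. *)
Lemma elementary_newton : is_newton (fun i => (-1) ^+ i.-1 * ps i) el.
Proof.
split=> [|r].
  apply/seriesP=> u; rewrite elementaryE series_coef1 mdeg_eq0.
  case: eqP => //= ->; rewrite (introT (sqfreeP _)) // => y.
  by rewrite cm1.
apply/seriesP=> u; pose H i := (\sum_(y <- finsupp u) hook i u y)%N.
have -> : (el r.+1 *+ r.+1) u = el r.+1 u *+ r.+1.
  by elim: {2 4}r.+1 => [|m IH]; rewrite ?mulr0n // !mulrS -IH.
rewrite series_coef_sum.
have step (i : 'I_r.+1) : ((-1) ^+ i.+1.-1 * ps i.+1 * el (r - i)%N) u
    = (-1) ^+ i * ((H i.+1 + H i.+2)%N * (mdeg u == r.+1))%:R.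
  rewrite -mulrA -signr_odd -[in RHS]signr_odd.
  have -> : ((-1) ^+ odd i.+1.-1 * (ps i.+1 * el (r - i)%N)) u
      = (-1) ^+ odd i * (ps i.+1 * el (r - i)%N) u.
    by case: odd; rewrite ?(expr0, expr1, mul1r, mulN1r).
  congr (_ * _); rewrite coef_power_sumM // big_mkcond /H -big_split.
  rewrite big_distrl natr_sum; apply: eq_bigr => y _.
  have excl : hook i.+1 u y && hook i.+2 u y = false.
    by apply/negP=> /andP[/hookP[uy _] /hookP[uy' _]]; lia.
  case: ifP => iu; last first.
    have -> : hook i.+1 u y = false.
      by apply/negP=> /hookP[uy _]; rewrite uy leqnn in iu.
    have -> // : hook i.+2 u y = false.
      by apply/negP=> /hookP[uy _]; rewrite uy leqnSn in iu.
  rewrite elementaryE sqfree_div_mpow //.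
  have := mdeg_divcm (mpow_div iu); rewrite mdeg_mpow => ->.
  set w := divcm _ _ => /=; have -> : ((i.+1 + mdeg w)%N == r.+1) = (mdeg w == (r - i)%N).
    by have lti := ltn_ord i; apply/eqP/eqP; lia.
  by move: excl; case: hook; case: hook; case: (_ == _).
rewrite (eq_bigr _ (fun i _ => step i)) elementaryE.
have [dr|] := eqVneq (mdeg u) r.+1; last first.
  move=> _; rewrite mul0rn big1 // => i _; by rewrite muln0 mulr0.
(* [H i] counts the letters [y] for which [u] is [y ^ i] times a squarefree
   monomial; the alternating sum telescopes. *)
have tel m : \sum_(i < m) (-1) ^+ i * ((H i.+1 + H i.+2)%N * true)%:R
   = (H 1%N)%:R - (-1) ^+ m * (H m.+1)%:R :> F.
  elim: m => [|m IH]; first by rewrite big_ord0 expr0 mul1r subrr.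
  rewrite big_ord_recr /= IH muln1 natrD exprS; ring.
rewrite tel.
have -> : H r.+2 = 0%N.
  rewrite /H big1 // => y _; case: hookP => // -[uy _].
  by have := mdeg_ge u y; rewrite uy dr ltnn.
rewrite mulr0 subr0 -[LHS]mulr_natr -natrM; congr (_%:R).
rewrite andTb mulnC /H -dr; case: sqfreeP => h; last first.
  rewrite muln0 big1 // => y _; case: hookP => // -[uy hz]; case: h => z.
  by have [->|/hz//] := eqVneq z y; rewrite uy.
rewrite muln1 mdegE; apply: eq_big_seq => y yu.
have uy : u y = 1%N by apply/eqP; rewrite eqn_leq h lt0n cmE_neq0.
by rewrite uy; case: hookP => // -[].
Qed.

End Elementary.

Section SymFun.
Context (F : numFieldType).
Implicit Types (f g : symfun F).

Definition psf r : symfun F := if r is r'.+1 then << part_single r' >> else 0.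

(** Newton's recursion defines the elementary functions from the power sums,
    without reference to an alphabet. *)
Definition esf r : symfun F := newton (fun i => (-1) ^+ i.-1 * psf i) r.

Lemma ev_psf (A : comAlgType F) (p : nat -> A) r : ev p (psf r.+1) = p r.+1.
Proof. by rewrite /= ev_basis /psi big_seq1. Qed.

Lemma ev_esf (A : comAlgType F) (p : nat -> A) r :
  ev p (esf r) = newton (fun i => (-1) ^+ i.-1 * p i) r.
Proof.
apply: newton_morph => {}r; rewrite rmorphM rmorphXn rmorphN1.
by congr (_ * _); apply: ev_psf.
Qed.

Lemma sym_evalE (Y : choiceType) f : sym_eval Y f = ev (power_sum F Y) f.
Proof. by rewrite evE. Qed.

Lemma ev_esf_elementary (Y : choiceType) r :
  ev (power_sum F Y) (esf r) = elementary F Y r.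
Proof. by rewrite ev_esf; apply/esym/newton_eq/elementary_newton. Qed.

End SymFun.

(** * The scalar product and the adjoint of a power sum *)

(** A partition is the product of its largest part and of the others. *)
Lemma part_ind (P : intpart -> Prop) : P mone ->
  (forall r la, P la -> P (mmul (part_single r) la)) -> forall la, P la.
Proof.
move=> P1 PM [s ps]; elim: s ps => [|r s IH] ps.
  by rewrite (_ : IntPart ps = mone) //; apply: val_inj.
case: r ps => [|r] ps; first by case/andP: (ps) => _; rewrite inE eqxx.
have ps' : is_part s.
  case/andP: (ps) => /path_sorted ss; rewrite inE negb_or => /andP[_ s0].
  exact/andP.
rewrite (_ : IntPart ps = mmul (part_single r) (IntPart ps')); first exact: PM.
by apply: intpartP; rewrite perm_sym (permPl (partMP _ _)).
Qed.

Lemma sumn_partM (la mu : intpart) : sumn (mmul la mu) = (sumn la + sumn mu)%N.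
Proof. by rewrite (perm_sumn (partMP la mu)) sumn_cat. Qed.

Lemma size_partM (la mu : intpart) : size (mmul la mu) = (size la + size mu)%N.
Proof. by rewrite (perm_size (partMP la mu)) size_cat. Qed.

(** [zpart] on arbitrary sequences, so that entries can be removed in any
    order. *)
Definition zseq (s : seq nat) :=
  (\prod_(i <- undup s) (i ^ count_mem i s * (count_mem i s)`!))%N.

Lemma perm_zseq s t : perm_eq s t -> zseq s = zseq t.
Proof.
move=> st; rewrite /zseq (perm_big _ (perm_undup (perm_mem st))).
by apply: eq_bigr => i _; rewrite (seq.permP st).
Qed.

Lemma zseq_cons r s : zseq (r :: s) = (r * (count_mem r s).+1 * zseq s)%N.
Proof.
rewrite /zseq /=; case: ifP => rs; last first.
  rewrite big_cons eqxx (count_memPn _) ?rs // addn0 expn1 !muln1.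
  congr (_ * _)%N; apply: eq_big_seq => i; rewrite mem_undup => si.
  by case: eqP => // ri; rewrite ri si in rs.
rewrite (bigD1_seq r) ?mem_undup ?undup_uniq //= eqxx add1n expnS factS.
rewrite [in RHS](bigD1_seq r) ?mem_undup ?undup_uniq //=.
rewrite [in LHS](eq_bigr (fun i =>
    (i ^ count_mem i s * (count_mem i s)`!)%N)); last first.
  by move=> i; rewrite eq_sym => /negbTE->.
set P := (\prod_(i <- _ | _) _)%N; rewrite -!mulnA; congr (_ * _)%N.
by rewrite mulnCA.
Qed.

Lemma zpart_cons r (la : intpart) :
  zpart (mmul (part_single r) la) =
    (r.+1 * (count_mem r.+1 (la : seq nat)).+1 * zpart la)%N.
Proof. by rewrite -zseq_cons; apply/perm_zseq/partMP. Qed.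

Lemma zpart_gt0 (la : intpart) : (0 < zpart la)%N.
Proof.
elim/part_ind: la => [|r la h]; first by rewrite /zpart big_nil.
by rewrite zpart_cons !muln_gt0.
Qed.

Section SymFunBasis.
Context (F : numFieldType).
Implicit Types (f g : symfun F) (la mu : intpart).

Lemma symfunU (c : F) la : << c *g la >> = c *: << la >> :> symfun F.
Proof.
by apply/malgP=> mu; rewrite mcoeffZ !mcoeffU; case: eqP; rewrite ?mulr1 ?mulr0.
Qed.

Lemma symfun_ind (P : symfun F -> Prop) : P 0 ->
  (forall c la f, P f -> P (c *: << la >> + f)) -> forall f, P f.
Proof.
move=> P0 PD f; rewrite [f]monalgE.
by elim/big_rec: _ => // la g _ Pg; rewrite symfunU; apply: PD.
Qed.

Lemma symfunUM la mu : << la >> * << mu >> = << mmul la mu >> :> symfun F.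
Proof. by rewrite malgM_def fgmulUU mulr1. Qed.

Lemma mcoeff_mul1 f g : mcoeff mone (f * g) = mcoeff mone f * mcoeff mone g.
Proof. exact: (mcoeff1g_is_multiplicative _ _).1. Qed.

End SymFunBasis.

Section JackDot.
Context (F : numFieldType) (alpha : F).
Implicit Types (f g h : symfun F) (la mu : intpart).
Local Notation dot := (jack_dot alpha).

Lemma jack_dotEw (d : {fset intpart}) f g : (msupp f `<=` d)%fset ->
  dot f g = \sum_(la <- d) mcoeff la f * mcoeff la g * ((zpart la)%:R * alpha ^+ size la).
Proof.
move=> le; rewrite /jack_dot (big_fset_incl _ le) //= => la _ /mcoeff_outdom->.
by rewrite !mul0r.
Qed.

Lemma jack_dotC f g : dot f g = dot g f.
Proof.
rewrite (@jack_dotEw (msupp f `|` msupp g)%fset) ?fsubsetUl //.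
rewrite (@jack_dotEw (msupp f `|` msupp g)%fset g) ?fsubsetUr //.
by apply: eq_bigr => la _; rewrite (mulrC (mcoeff la f)).
Qed.

Lemma jack_dotDr f g h : dot f (g + h) = dot f g + dot f h.
Proof.
by rewrite -big_split /=; apply: eq_bigr => la _; rewrite mcoeffD mulrDr mulrDl.
Qed.

Lemma jack_dotZr c f g : dot f (c *: g) = c * dot f g.
Proof. by rewrite mulr_sumr; apply: eq_bigr => la _; rewrite mcoeffZ; ring. Qed.

Lemma jack_dot0r f : dot f 0 = 0.
Proof. by rewrite -(scale0r 0) jack_dotZr mul0r. Qed.

Lemma jack_dotDl f g h : dot (f + g) h = dot f h + dot g h.
Proof. by rewrite !(jack_dotC _ h) jack_dotDr. Qed.

Lemma jack_dotZl c f g : dot (c *: f) g = c * dot f g.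
Proof. by rewrite !(jack_dotC _ g) jack_dotZr. Qed.

Lemma jack_dot0l f : dot 0 f = 0.
Proof. by rewrite jack_dotC jack_dot0r. Qed.

Lemma jack_dot_suml I (s : seq I) (P : pred I) (h : I -> symfun F) f :
  dot (\sum_(i <- s | P i) h i) f = \sum_(i <- s | P i) dot (h i) f.
Proof.
by elim/big_rec2: _ => [|i x y _ <-]; rewrite ?jack_dot0l ?jack_dotDl.
Qed.

Lemma jack_dot_sumr I (s : seq I) (P : pred I) (h : I -> symfun F) f :
  dot f (\sum_(i <- s | P i) h i) = \sum_(i <- s | P i) dot f (h i).
Proof. by rewrite jack_dotC jack_dot_suml; under eq_bigr do rewrite jack_dotC. Qed.

Lemma jack_dot_basis f la :
  dot f << la >> = mcoeff la f * ((zpart la)%:R * alpha ^+ size la).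
Proof.
rewrite jack_dotC (jack_dotEw f (msuppU_le (k := la) (x := 1))).
by rewrite big_seq_fset1 mcoeffUU mul1r.
Qed.

(** The scalar product is diagonal in the basis of the power sums. *)
Lemma jack_dot_nondegenerate f : alpha != 0 -> (forall g, dot f g = 0) -> f = 0.
Proof.
move=> a0 h; apply/malgP=> la; rewrite mcoeff0.
have /eqP := h << la >>; rewrite jack_dot_basis mulf_eq0 => /orP[/eqP//|].
by rewrite mulf_eq0 expf_eq0 (negbTE a0) andbF pnatr_eq0 eqn0Ngt zpart_gt0.
Qed.

Lemma is_part_rem r la : is_part (rem r la).
Proof.
apply/andP; split.
  exact: (subseq_sorted geq_trans (rem_subseq _ _) (parts_sorted la)).
by apply: contra (parts_neq0 la); apply: mem_rem.
Qed.

Definition part_rem r la : intpart := IntPart (is_part_rem r la).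

Lemma part_remK r la : r.+1 \in (la : seq nat) ->
  mmul (part_single r) (part_rem r.+1 la) = la.
Proof.
move=> rla; apply: intpartP; rewrite (permPl (partMP _ _)) perm_sym.
exact: perm_to_rem.
Qed.

Lemma part_consK r la : part_rem r.+1 (mmul (part_single r) la) = la.
Proof.
apply: intpartP; rewrite -(perm_cons r.+1) perm_sym.
rewrite -(permPl (partMP (part_single r) la)) perm_to_rem //.
by rewrite (perm_mem (partMP _ _)) inE eqxx.
Qed.

(** The adjoint of the multiplication by [p_r]: it is the derivation
    [alpha r d/dp_r]. *)
Definition adjD r : symfun F -> symfun F :=
  locked (mmap (in_alg (symfun F)) (fun la : intpart =>
    (alpha * (r * count_mem r (la : seq nat))%:R) *: << part_rem r la >>)).

Lemma adjD0 r : adjD r 0 = 0.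
Proof. by rewrite /adjD -lock raddf0. Qed.

Lemma adjDD r f g : adjD r (f + g) = adjD r f + adjD r g.
Proof. by rewrite /adjD -lock raddfD. Qed.

Lemma adjDZ r c f : adjD r (c *: f) = c *: adjD r f.
Proof.
rewrite /adjD -lock (mmapEw (msuppZ_le _ _)) mmapE scaler_sumr /=.
by apply: eq_bigr => la _; rewrite mcoeffZ !mulr_algl -[_ *: _ in LHS]scalerA.
Qed.

Lemma adjD_basis r la : adjD r << la >> =
  (alpha * (r * count_mem r (la : seq nat))%:R) *: << part_rem r la >>.
Proof. by rewrite /adjD -lock mmapU mulr_algl scale1r. Qed.

Lemma adjDP r f la :
  dot (adjD r.+1 f) << la >> = dot f << mmul (part_single r) la >>.
Proof.
elim/symfun_ind: f => [|c mu f IH]; first by rewrite adjD0 !jack_dot0l.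
rewrite adjDD adjDZ 2!jack_dotDl 2!jack_dotZl {}IH; congr (_ * _ + _).
rewrite adjD_basis jack_dotZl !jack_dot_basis !mcoeffU1.
have [rmu|rmu] := boolP (r.+1 \in (mu : seq nat)); last first.
  rewrite (count_memPn rmu) muln0 mulr0 mul0r.
  case: eqP => [e|]; last by rewrite mul0r.
  by rewrite e (perm_mem (partMP _ _)) inE eqxx in rmu.
have [<-|ne] := eqVneq (part_rem r.+1 mu) la; last first.
  rewrite mul0r mulr0; case: eqP => [e|]; last by rewrite mul0r.
  by rewrite e part_consK eqxx in ne.
have := zpart_cons r (part_rem r.+1 mu).
have := size_partM (part_single r) (part_rem r.+1 mu).
rewrite part_remK // eqxx !mul1r => -> ->.
rewrite count_rem rmu /= eqxx subn1 prednK -?has_count ?has_pred1 //.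
by rewrite exprS !natrM; ring.
Qed.

Lemma part_remM r la mu : r \in (la : seq nat) ->
  part_rem r (mmul la mu) = mmul (part_rem r la) mu.
Proof.
move=> rla; apply: intpartP; rewrite -(perm_cons r) perm_sym.
have rM : r \in (mmul la mu : seq nat).
  by rewrite (perm_mem (partMP _ _)) mem_cat rla.
rewrite -(permPr (perm_to_rem rM)) (permPr (partMP _ _)).
rewrite (perm_trans (y := r :: rem r la ++ mu)) //.
  by rewrite perm_cons; apply: partMP.
by rewrite -cat_cons perm_cat2r perm_sym perm_to_rem.
Qed.

Lemma adjD_mul_basis r la mu :
  adjD r (<< la >> * << mu >>) =
    adjD r << la >> * << mu >> + << la >> * adjD r << mu >>.
Proof.
rewrite symfunUM !adjD_basis -scalerAl -scalerAr !symfunUM.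
have -> : count_mem r (mmul la mu : seq nat)
    = (count_mem r (la : seq nat) + count_mem r (mu : seq nat))%N.
  by rewrite (seq.permP (partMP la mu)) count_cat.
have -> a b : alpha * (r * (a + b))%:R = alpha * (r * a)%:R + alpha * (r * b)%:R.
  by rewrite mulnDr natrD mulrDr.
rewrite scalerDl.
apply: congr2.
  have [rla|rla] := boolP (r \in (la : seq nat)); first by rewrite part_remM.
  by rewrite (count_memPn rla) muln0 mulr0 !scale0r.
have [rmu|rmu] := boolP (r \in (mu : seq nat)).
  by rewrite mulmC part_remM // mulmC.
by rewrite (count_memPn rmu) muln0 mulr0 !scale0r.
Qed.

Let mulDZ (A : comAlgType F) (d : F) (a m g : A) :
  a * (d *: m + g) = d *: (a * m) + a * g.
Proof. by rewrite mulrDr scalerAr. Qed.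

Let leibnizDZ (A : comAlgType F) (d : F) (a m g a' m' g' : A) :
  d *: (a' * m + a * m') + (a' * g + a * g') =
  a' * (d *: m + g) + a * (d *: m' + g').
Proof. by rewrite !mulrDr scalerDr !scalerAr addrACA. Qed.

Let leibniz0 (A : comAlgType F) (a a' : A) : 0 = a' * 0 + a * 0.
Proof. by rewrite !mulr0 addr0. Qed.

Lemma adjDM r f g : adjD r (f * g) = adjD r f * g + f * adjD r g.
Proof.
elim/symfun_ind: g => [|d mu g IHg].
  by rewrite [f * 0]mulr0 adjD0; apply: leibniz0.
have fmu : adjD r (f * << mu >>) = adjD r f * << mu >> + f * adjD r << mu >>.
  rewrite mulrC [RHS]addrC [f * _]mulrC [_ * << mu >>]mulrC.
  elim/symfun_ind: f {IHg} => [|c la f IHf].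
    by rewrite [_ * 0]mulr0 adjD0; apply: leibniz0.
  rewrite (mulDZ c << mu >>) adjDD adjDZ adjD_mul_basis [X in _ + X = _]IHf.
  rewrite adjDD adjDZ; exact: leibnizDZ.
rewrite (mulDZ d f) adjDD adjDZ fmu [X in _ + X = _]IHg adjDD adjDZ.
exact: leibnizDZ.
Qed.

End JackDot.

(** * The reproducing kernel *)

Section Derivation.
Context (F : numFieldType) (A : comAlgType F) (D : A -> A).
Hypotheses (DD : forall a b, D (a + b) = D a + D b).
Hypotheses (DM : forall a b, D (a * b) = D a * b + a * D b).

Lemma derivation0 : D 0 = 0.
Proof. by apply: (addIr (D 0)); rewrite -DD !add0r. Qed.

Lemma derivation1 : D 1 = 0.
Proof.
by apply: (addIr (D 1)); rewrite add0r -[in RHS](mulr1 1) DM mulr1 mul1r.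
Qed.

Lemma derivation_sum I (s : seq I) (h : I -> A) :
  D (\sum_(i <- s) h i) = \sum_(i <- s) D (h i).
Proof.
by elim: s => [|i s IH]; rewrite ?big_nil ?derivation0 // !big_cons DD IH.
Qed.

Lemma derivationMn a m : D (a *+ m) = D a *+ m.
Proof. by elim: m => [|m IH]; rewrite ?derivation0 // !mulrS DD IH. Qed.

Lemma derivation_prod (I : eqType) (s : seq I) (h : I -> A) : uniq s ->
  D (\prod_(i <- s) h i) =
    \sum_(i <- s) D (h i) * \prod_(j <- s | j != i) h j.
Proof.
elim: s => [|i s IH] /=; first by rewrite !big_nil derivation1.
case/andP=> si us; rewrite !big_cons DM IH // eqxx /=; congr (_ * _ + _).
  rewrite [RHS]big_seq_cond [LHS]big_seq_cond; apply: eq_bigl => j.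
  by case js: (j \in s) => //=; case: eqP js si => // -> ->.
rewrite mulr_sumr; apply: eq_big_seq => j js.
by rewrite big_cons; case: eqP js si => [->->//|_ _ _]; rewrite mulrCA.
Qed.

(** A derivation that only sees the term of index [r] of a sequence acts on
    the generating function [exp (\sum p_i t ^ i / i)] as the multiplication
    by a multiple of [t ^ r]. *)
Lemma derivation_newton (p : nat -> A) (c : F) r :
    (forall i, D (p i.+1) = if i == r then (c * r.+1%:R)%:A else 0) ->
  forall a, D (newton p a) =
    c *: (if (r < a)%N then newton p (a - r.+1)%N else 0).
Proof.
move=> Dp; have [p0 pS] := newtonP p.
elim/ltn_ind=> -[|a] IH; first by rewrite p0 derivation1 scaler0.
pose e' b := if (r < b)%N then newton p (b - r.+1)%N else 0.
apply: (@mulrSn_inj F _ a); rewrite /= -derivationMn pS derivation_sum.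
rewrite (eq_bigr (fun i : 'I_a.+1 =>
   (if (i == r :> nat) then (c * r.+1%:R) *: newton p (a - i)%N else 0)
   + c *: (p i.+1 * e' (a - i)%N))); last first.
  move=> i _; rewrite DM Dp IH ?ltnS ?leq_subr // -/(e' _) -scalerAr.
  by congr (_ + _); case: eqP => _; rewrite ?mul0r // mulr_algl.
rewrite big_split /= -scaler_sumr -big_mkcond /=.
have [ra|ra] := leqP r a; last first.
  rewrite ltnS leqNgt ra /= scaler0 mul0rn.
  rewrite big_pred0 => [|i]; last first.
    by apply/eqP=> ir; have := ltn_ord i; rewrite ir ltnS leqNgt ra.
  rewrite big1 ?scaler0 ?addr0 // => i _; rewrite /e' ifF ?mulr0 //.
  by apply/negbTE; rewrite -leqNgt (leq_trans (leq_subr _ _)) // ltnW.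
rewrite ltnS ra subSS (big_pred1 (inord r)) => [|i]; last first.
  by apply/eqP/eqP=> [ir|->]; [apply: val_inj|]; rewrite /= inordK.
rewrite inordK //; set b := (a - r)%N.
have ab : a = (r + b)%N by rewrite /b subnKC.
have -> : \sum_(i < a.+1) p i.+1 * e' (a - i)%N = newton p b *+ b.
  rewrite -(big_mkord xpredT (fun i => p i.+1 * e' (a - i)%N)).
  rewrite (@big_cat_nat _ _ _ b) //=; last by rewrite ab; lia.
  have -> : \sum_(b <= i < a.+1) p i.+1 * e' (a - i)%N = 0.
    rewrite big_nat_cond big1 // => i /andP[/andP[bi ia] _].
    by rewrite /e' ifF ?mulr0 //; apply/negbTE; lia.
  rewrite addr0.
  rewrite big_mkord; case: (b) ab => [|b'] ab; first by rewrite big_ord0.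
  rewrite pS; apply: eq_bigr => i _; have ib := ltn_ord i.
  by rewrite /e' ifT ?ab; [congr (_ * newton p _)|]; lia.
rewrite -[newton p b *+ b]scaler_nat -[RHS]scaler_nat !scalerA -scalerDl.
congr (_ *: _); rewrite -mulrDr -natrD mulrC; congr (_%:R * _).
by rewrite addSn -ab.
Qed.

End Derivation.

Section Signs.
Context (F : numFieldType) (A : comAlgType F).
Implicit Types (a : A).

Lemma signZ i a : (-1) ^+ i * a = (-1) ^+ i *: a.
Proof.
by rewrite -signr_odd -[in RHS]signr_odd; case: odd;
   rewrite ?expr0 ?expr1 ?mul1r ?mulN1r ?scale1r ?scaleN1r.
Qed.

Lemma sign_signZ a r : (-1) ^+ r *: ((-1) ^+ r *: a) = a.
Proof. by rewrite scalerA -exprD addnn -mul2n exprM sqrrN !expr1n scale1r. Qed.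

Lemma sign_sign_scale a r k : (-1) ^+ r * (((-1) ^+ r * k%:R) *: a) = a *+ k.
Proof. by rewrite signZ -scalerA sign_signZ scaler_nat. Qed.

End Signs.

Section Pairing.
Context (F : numFieldType) (alpha : F) (n : nat).
Implicit Types (f g : symfun F) (u : {cmonom 'I_n}).
Local Notation D r := (adjD alpha r).
Local Notation sp i := ((-1) ^+ i * psf F i.+1).

Lemma esf0 : esf F 0 = 1.
Proof. exact: (newtonP _).1. Qed.

Lemma esfS a : esf F a.+1 *+ a.+1 = \sum_(i < a.+1) sp i * esf F (a - i)%N.
Proof. exact: (newtonP _).2. Qed.

Lemma adjD_esf r a : D r.+1 (esf F a) =
  ((-1) ^+ r * alpha) *: (if (r < a)%N then esf F (a - r.+1)%N else 0).
Proof.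
apply: derivation_newton => [||i]; [exact: adjDD|exact: adjDM|].
rewrite /= signZ adjDZ adjD_basis /= addn0 eqSS.
case: eqP => [->|_]; last by rewrite muln0 mulr0 scale0r scaler0.
rewrite muln1 scalerA mulrA.
by congr (_ *: << _ >>); apply: val_inj; rewrite /= eqxx.
Qed.

Definition esf_prod u : symfun F := \prod_(i < n) esf F (u i).

Lemma big_finsupp (V : nmodType) (G : 'I_n -> V) r u :
  \sum_(y <- finsupp u | (r < u y)%N) G y = \sum_(y | (r < u y)%N) G y.
Proof.
rewrite -big_filter -[RHS]big_filter; apply: perm_big; apply: uniq_perm.
- exact/filter_uniq/fset_uniq.
- exact/filter_uniq/index_enum_uniq.
move=> y; rewrite !mem_filter mem_index_enum andbT.
by case: (mdomP u y) => _; rewrite ?andbT ?andbF.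
Qed.

Lemma prod_divcm (A : comNzRingType) (h : nat -> A) (u : {cmonom 'I_n}) y r :
  \prod_i h (divcm u (expcmn (ucm y) r) i) =
    h (u y - r)%N * \prod_(i | i != y) h (u i).
Proof.
rewrite (bigD1 y) //= divcmE mpowE eqxx mul1n; congr (_ * _).
by apply: eq_bigr => j jy; rewrite divcmE mpowE eq_sym (negbTE jy) subn0.
Qed.

Lemma adjD_esf_prod r u : D r.+1 (esf_prod u) = ((-1) ^+ r * alpha) *:
  \sum_(y <- finsupp u | (r < u y)%N) esf_prod (divcm u (expcmn (ucm y) r.+1)).
Proof.
rewrite big_finsupp scaler_sumr [RHS]big_mkcond /esf_prod.
rewrite (derivation_prod (adjDM alpha r.+1)) ?index_enum_uniq //.
apply: eq_bigr => y _; rewrite adjD_esf; case: ifP => ry.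
  by rewrite -scalerAl prod_divcm.
by rewrite scaler0 mul0r.
Qed.

Lemma esf_const a : mcoeff mone (esf F a) = (a == 0%N)%:R.
Proof.
case: a => [|a]; first by rewrite esf0 mcoeff1 eqxx.
apply: (@mulrSn_inj F F^o a); rewrite /= mul0rn -mcoeffMn esfS raddf_sum.
apply: big1 => i _; rewrite /= mcoeff_mul1 signZ mcoeffZ mcoeffU1.
by rewrite mulr0 mul0r.
Qed.

Lemma esf_prod_const u : mcoeff mone (esf_prod u) = (u == mone)%:R.
Proof.
transitivity (\prod_(i < n) mcoeff mone (esf F (u i))).
  rewrite /esf_prod; elim/big_rec2: _ => [|i x y _ <-]; first by rewrite mcoeff1 eqxx.
  exact: mcoeff_mul1.
case: eqP => [->|ne]; first by rewrite big1 // => i _; rewrite cm1 esf_const.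
have [/existsP[i ui]|/existsPn no] := boolP [exists i, u i != 0%N].
  by rewrite (bigD1 i) //= esf_const (negbTE ui) mul0r.
by case: ne; apply/eqP/cmP=> i; have := no i; rewrite negbK cm1 => /eqP.
Qed.

(** Pairing with the generating function of the elementary functions in the
    letters [x_i] sends [p_r] to [(-1) ^ (r - 1) alpha p_r(x)]. *)
Definition jack_dual : symfun F -> series 'I_n F :=
  ev (fun r => ((-1) ^+ r.-1 * alpha) *: power_sum F 'I_n r).

(** The reproducing kernel of the scalar product: as functions of a second
    alphabet, [\prod_i \sum_a e_a x_i ^ a] is the exponential of
    [\sum_r (-1) ^ (r - 1) p_r p_r(x) / r], so that pairing with it amounts to
    the substitution of [(-1) ^ (r - 1) alpha p_r(x)] for [p_r].  *)
Lemma jack_dot_esf_prod u f : jack_dot alpha (esf_prod u) f = jack_dual f u.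
Proof.
elim/symfun_ind: f => [|c la f IH].
  by rewrite jack_dot0r /jack_dual ev0.
rewrite jack_dotDr jack_dotZr /jack_dual evD evZ -/jack_dual IH.
rewrite series_coefD series_coefZ; congr (_ * _ + _); clear IH.
elim/part_ind: la u => [|r la IH] u.
  rewrite jack_dot_basis esf_prod_const /jack_dual ev_basis /psi /zpart !big_nil.
  by rewrite series_coef1 [size _]/= expr0 mulr1n !mulr1.
rewrite -adjDP adjD_esf_prod jack_dotZl jack_dot_suml.
rewrite -symfunUM /jack_dual evM ev_basis /psi big_seq1 -/jack_dual.
rewrite -scalerAl series_coefZ coef_power_sumM //; congr (_ * _).
by apply: eq_bigr => y _; apply: IH.
Qed.

End Pairing.

(** * Complete functions with multiplicities, alternants, Lagrange interpolation *)

Section PowerIdeal.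
Context (F : numFieldType) (A : comAlgType F) (n : nat) (x : 'I_n -> A).
Implicit Types (c d : 'I_n -> nat).

(** Membership to the ideal generated by the powers [x_i ^ d_i]. *)
Definition in_powers d (a : A) := exists b : 'I_n -> A, a = \sum_i x i ^+ d i * b i.

Lemma in_powersD d a b : in_powers d a -> in_powers d b -> in_powers d (a + b).
Proof.
move=> [a' ->] [b' ->]; exists (fun i => a' i + b' i).
by rewrite -big_split; apply: eq_bigr => i _; rewrite mulrDr.
Qed.

Lemma in_powersM d a b : in_powers d a -> in_powers d (b * a).
Proof.
move=> [a' ->]; exists (fun i => b * a' i).
by rewrite mulr_sumr; apply: eq_bigr => i _; rewrite mulrCA.
Qed.

Lemma in_powers_single d i a : in_powers d (x i ^+ d i * a).
Proof.
exists (fun j => if j == i then a else 0).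
rewrite (bigD1 i) //= eqxx big1 ?addr0 // => j /negbTE->; exact: mulr0.
Qed.

Lemma in_powers_weak d d' a :
  (forall i, d' i <= d i)%N -> in_powers d a -> in_powers d' a.
Proof.
move=> le [b ->]; exists (fun i => x i ^+ (d i - d' i) * b i).
by apply: eq_bigr => i _; rewrite mulrA -exprD subnKC.
Qed.

Definition node_prod i := \prod_(j | j != i) (x j - x i).

(** For a constant [c] this is, up to sign, an even power of the Vandermonde
    product. *)
Definition node_powers c := \prod_i node_prod i ^+ c i.

Definition decr j c i := (c i - (i == j))%N.

Lemma node_powers_decr c j : (0 < c j)%N -> node_powers c = node_prod j * node_powers (decr j c).
Proof.
move=> cj; rewrite /node_powers (bigD1 j) //= [in RHS](bigD1 j) //= mulrA -exprS.
rewrite /decr eqxx subn1 prednK //; congr (_ * _).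
by apply: eq_bigr => i /negbTE->; rewrite subn0.
Qed.

Lemma sum_decr c j : (0 < c j)%N -> (\sum_i c i = (\sum_i decr j c i).+1)%N.
Proof.
move=> cj; rewrite (bigD1 j) //= [in RHS](bigD1 j) //= /decr eqxx subn1.
rewrite -{1}(prednK cj) addSn; congr (_ + _).+1.
by apply: eq_bigr => i /negbTE->; rewrite subn0.
Qed.

(** The complete symmetric functions of the alphabet in which the letter
    [x i] is repeated [c i] times. *)
Definition multi_complete c := newton (fun r => \sum_i x i ^+ r *+ c i).

Lemma multi_complete_decr c j r : (0 < c j)%N ->
  multi_complete c r.+1 - x j * multi_complete c r =
  multi_complete (decr j c) r.+1.
Proof.
move=> cj; rewrite /multi_complete newton_remove.
apply: eq_newton => {}r; rewrite (bigD1 j) //= [in RHS](bigD1 j) //=.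
have -> : decr j c j = (c j).-1 by rewrite /decr eqxx subn1.
rewrite -{1}(prednK cj) mulrS -[LHS]addrA addrC addrA subrK.
rewrite addrC; congr (_ + _); apply: eq_bigr => i /negbTE ij.
by rewrite /decr ij subn0.
Qed.

(** Partial fractions without denominators.  The divided difference
    [(x_i - x_j) h_r(c) = h_(r+1)(c - e_j) - h_(r+1)(c - e_i)] lowers the
    multiplicities, at the cost of a factor that [node_powers c] provides, until a
    single letter is left, whose complete functions are multiples of its
    powers. *)
Lemma node_powers_complete c r (i0 : 'I_n) :
  in_powers (fun i => r + \sum_j c j - c i)%N (node_powers c * multi_complete c r).
Proof.
move: {2}(\sum_j c j)%N (erefl (\sum_j c j)%N) => K.
elim: K c r => [|K IH] c r cK.
  have c0 i : c i = 0%N.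
    by apply/eqP; rewrite -leqn0 -cK (bigD1 i) //= leq_addr.
  have -> : multi_complete c r = x i0 ^+ (r + \sum_j c j - c i0) * (r == 0%N)%:R.
    rewrite cK c0 addn0 subn0 /multi_complete (eq_newton (q := fun=> 0)).
      by rewrite newton0; case: eqP => [->|_]; rewrite ?expr0 ?mulr1 ?mulr0.
    by move=> s; rewrite big1 // => i _; rewrite c0.
  exact/in_powersM/(in_powers_single (fun i => r + _ - c i)%N).
have [/existsP[i /existsP[j /and3P[ij ci cj]]]|no] := boolP [exists i, exists j,
    [&& i != j, (0 < c i)%N & (0 < c j)%N]].
  have ji : j != i by rewrite eq_sym.
  have cji : (0 < decr j c i)%N by rewrite /decr (negbTE ij) subn0.
  have cij : (0 < decr i c j)%N by rewrite /decr (negbTE ji) subn0.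
  have decC : node_powers (decr j (decr i c)) = node_powers (decr i (decr j c)).
    by apply: eq_bigr => l _; rewrite /decr subnAC.
  (* The products attached to [i] and to [j] both contain [x_i - x_j], up to
     sign: one copy is spent on the divided difference, and the other one
     completes the product for the lowered multiplicities. *)
  pose Wi := \prod_(l | (l != i) && (l != j)) (x l - x i).
  pose Wj := \prod_(l | (l != j) && (l != i)) (x l - x j).
  have Wi_eq : node_prod i = (x j - x i) * Wi by rewrite /node_prod (bigD1 j).
  have Wj_eq : node_prod j = (x i - x j) * Wj by rewrite /node_prod (bigD1 i).
  have e : node_powers c * multi_complete c r =
      Wj * (node_powers (decr j c) * multi_complete (decr j c) r.+1)
      + Wi * (node_powers (decr i c) * multi_complete (decr i c) r.+1).
    rewrite -!multi_complete_decr // (node_powers_decr cj) (node_powers_decr cji).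
    by rewrite (node_powers_decr cij) decC Wi_eq Wj_eq; ring.
  rewrite e; apply: in_powersD; apply: in_powersM.
    apply: in_powers_weak (IH (decr j c) r.+1 _); last first.
      by apply: succn_inj; rewrite -sum_decr.
    by move=> l; rewrite (sum_decr cj) /decr; lia.
  apply: in_powers_weak (IH (decr i c) r.+1 _); last first.
    by apply: succn_inj; rewrite -sum_decr.
  by move=> l; rewrite (sum_decr ci) /decr; lia.
have [i ci] : exists i, (0 < c i)%N.
  apply/existsP; apply: contraT => /existsPn h; move: cK; rewrite big1 // => i _.
  by apply/eqP; rewrite -leqn0 leqNgt; apply: h.
have c0 j : j != i -> c j = 0%N.
  move=> ji; apply/eqP; rewrite -leqn0 leqNgt; apply/negP=> cj.
  by case/negP: no; apply/existsP; exists i; apply/existsP; exists j; rewrite eq_sym ji ci.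
have -> : multi_complete c r =
    x i ^+ (r + \sum_j c j - c i) * newton (fun=> 1 *+ c i) r.
  have -> : (r + \sum_j c j - c i = r)%N.
    by rewrite (bigD1 i) //= big1 ?addn0 ?addnK // => j /c0.
  rewrite -newton_scale; apply: eq_newton => s.
  rewrite (bigD1 i) //= big1 ?addr0 => [|j /c0->]; last by rewrite mulr0n.
  by rewrite mulr_natr.
exact/in_powersM/(in_powers_single (fun i => r + _ - c i)%N).
Qed.

End PowerIdeal.

Section Alternant.
Context (F : numFieldType) (A : comAlgType F) (n : nat) (x : 'I_n -> A).

Definition vandermonde := \prod_(i < n) \prod_(j < n | (i < j)%N) (x j - x i).

Lemma alternant_vandermonde :
  \sum_(s : 'S_n) (-1) ^+ s * \prod_i x i ^+ (s i) = vandermonde.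
Proof.
rewrite /vandermonde; transitivity (\det (Vandermonde n (\row_i x i))); last first.
  rewrite det_Vandermonde; apply: eq_bigr => i _; apply: eq_bigr => j _.
  by rewrite !mxE.
rewrite -det_tr; apply: eq_bigr => s _; congr (_ * _).
by apply: eq_bigr => i _; rewrite !mxE.
Qed.

(** Expanding the power of the determinant yields the signed sum over tuples of
    permutations that defines the hyperdeterminant. *)
Lemma alternant_power N :
  \sum_(s : {ffun 'I_N -> 'S_n})
    (\prod_j (-1) ^+ s j) * \prod_i x i ^+ (\sum_j s j i) = vandermonde ^+ N.
Proof.
rewrite -[in RHS](card_ord N) -prodr_const -alternant_vandermonde bigA_distr_bigA /=.
apply: eq_bigr => s _; rewrite big_split /=; congr (_ * _).
rewrite exchange_big; apply: eq_bigr => i _.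
by rewrite -prodrXr.
Qed.

(** Each unordered pair of letters occurs once with each sign in the product
    over ordered pairs. *)
Lemma vandermonde_sqr : vandermonde ^+ 2 = (-1) ^+ 'C(n, 2) * \prod_i node_prod x i.
Proof.
have oth : \prod_i node_prod x i = vandermonde * \prod_(i < n) \prod_(j < n | (j < i)%N) (x j - x i).
  rewrite -big_split; apply: eq_bigr => i _ /=; rewrite /node_prod.
  rewrite (bigID (fun j : 'I_n => (i < j)%N)) /=; congr (_ * _).
    by apply: eq_bigl => j; rewrite -val_eqE; case: ltngtP.
  by apply: eq_bigl => j; rewrite -val_eqE; case: ltngtP.
have rev : \prod_(i < n) \prod_(j < n | (j < i)%N) (x j - x i) = (-1) ^+ 'C(n, 2) * vandermonde.
  rewrite (exchange_big_dep xpredT) //= -bin2_sum big_mkord.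
  rewrite -prodrXr.
  transitivity (\prod_(j < n) \prod_(i < n | (j < i)%N) ((-1) * (x i - x j))).
    by apply: eq_bigr => j _; apply: eq_bigr => i _; rewrite mulN1r opprB.
  transitivity ((\prod_(j < n) \prod_(i < n | (j < i)%N) -1) * vandermonde).
    by rewrite -big_split; apply: eq_bigr => j _; rewrite -big_split.
  congr (_ * _); rewrite [RHS](reindex_inj rev_ord_inj).
  apply: eq_bigr => j _; rewrite prodr_const; congr (_ ^+ _) => /=.
  rewrite -sum1_card -(big_mkord (fun i => (j < i)%N) (fun=> 1%N)).
  rewrite (big_cat_nat (n := j.+1)) //= big_nat_cond big1 ?add0n; last first.
    by move=> i /andP[/andP[_ ij] ji]; lia.
  rewrite big_nat_cond (eq_bigl (fun i => (j < i < n)%N)); last first.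
    by move=> i; rewrite andbC andbA andbb.
  by rewrite -big_nat sum_nat_const_nat muln1.
rewrite oth rev; set e := (-1) ^+ _.
have ee : e * e = 1 by rewrite -exprD addnn -mul2n exprM sqrrN !expr1n.
by rewrite mulrA mulrA (mulrAC e vandermonde e) ee mul1r expr2.
Qed.

End Alternant.

Section Lagrange.
Context (I : finType).

Definition node_prod_in (R : comPzRingType) (x : I -> R) (S : {set I}) i :=
  \prod_(j in S | j != i) (x j - x i).

(** Lagrange's interpolation of the constant [1], evaluated at [0]. *)
Lemma lagrange_field (K : fieldType) (x : I -> K) (S : {set I}) :
    {in S &, injective x} -> S != set0 ->
  \sum_(i in S) \prod_(j in S | j != i) (x j / (x j - x i)) = 1.
Proof.
move=> inj S0.
pose q i : {poly K} := \prod_(j in S | j != i) ((x j - x i)^-1 *: ((x j)%:P - 'X)).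
pose p : {poly K} := \sum_(i in S) q i - 1%:P.
have qE i y : (q i).[y] = \prod_(j in S | j != i) ((x j - y) / (x j - x i)).
  rewrite horner_prod; apply: eq_bigr => j _.
  by rewrite hornerZ hornerD hornerN hornerX hornerC mulrC.
have sub0 i j : i \in S -> j \in S -> j != i -> x j - x i != 0.
  by move=> iS jS; apply: contra; rewrite subr_eq0 => /eqP/inj->.
suff p0 : p = 0.
  have /eqP := congr1 (fun r => r.[0]) p0.
  rewrite horner0 /p hornerD hornerN hornerC horner_sum subr_eq0 => /eqP e; apply: etrans e.
  apply: eq_bigr => i _; rewrite qE; by apply: eq_bigr => j _; rewrite subr0.
apply/eqP; apply: contraT => pn0.
have /(max_poly_roots pn0) : all (root p) [seq x i | i <- enum S].
  apply/allP=> _ /mapP[i iS ->]; rewrite mem_enum in iS.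
  rewrite rootE /p hornerD hornerN hornerC horner_sum (bigD1 i) //= qE.
  rewrite big1 => [|j /andP[jS ji]]; last first.
    by rewrite divff // sub0.
  rewrite big1 ?addr0 ?subrr // => j /andP[jS ji].
  by rewrite qE (bigD1 i) /= ?iS 1?eq_sym // subrr mul0r mul0r.
rewrite map_inj_in_uniq ?enum_uniq; last first.
  by move=> i j; rewrite !mem_enum; apply: inj.
move/(_ isT); rewrite size_map -cardE ltnNge => /negP[].
have [i iS] := set0Pn _ S0.
apply: leq_trans (size_polyD _ _) _; rewrite size_polyN polyC1 size_poly1 geq_max.
rewrite andbC card_gt0 S0 /=; apply: leq_trans (size_sum _ _ _) _.
apply/bigmax_leqP=> j jS; rewrite (cardD1 j) jS add1n.
apply: leq_trans (size_poly_prod_leq _ _) _.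
have -> : #|[predD1 S & j]| = #|[pred l in S | l != j]|.
  by apply: eq_card => l; rewrite !inE andbC.
rewrite leq_subLR addnS ltnS addnn -muln2 -sum_nat_const.
apply: leq_sum => l _; apply: leq_trans (size_scale_leq _ _) _.
by rewrite -opprB size_polyN size_XsubC.
Qed.

Lemma lagrange_field_prod (K : fieldType) (x : I -> K) (S : {set I}) :
    {in S &, injective x} -> S != set0 ->
  \sum_(i in S) (\prod_(j in S | j != i) x j) *
     \prod_(l in S | l != i) node_prod_in x S l = \prod_(l in S) node_prod_in x S l.
Proof.
move=> inj S0; transitivity (\prod_(l in S) node_prod_in x S l *
    \sum_(i in S) \prod_(j in S | j != i) (x j / (x j - x i))); last first.
  by rewrite lagrange_field // mulr1.
rewrite mulr_sumr.
apply: eq_bigr => i iS; rewrite prodf_div [in RHS](bigD1 i iS) /=.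
have l0 : node_prod_in x S i != 0.
  apply/prodf_neq0 => j /andP[jS ji].
  by apply: contra ji; rewrite subr_eq0 => /eqP/inj->.
rewrite -/(node_prod_in x S i) [RHS]mulrC mulrA divfK // mulrC.
Qed.

Lemma node_prod_in_morph (R R' : comPzRingType) (f : {rmorphism R -> R'}) (x : I -> R) S i :
  f (node_prod_in x S i) = node_prod_in (f \o x) S i.
Proof. by rewrite rmorph_prod; apply: eq_bigr => j _; rewrite rmorphB. Qed.

End Lagrange.

(** Both sides are polynomials in the letters, so that the identity follows
    from its instance in a field of rational functions. *)
Lemma lagrange_prod (F : fieldType) (n : nat) (A : comAlgType F) (x : 'I_n -> A)
    (S : {set 'I_n}) : S != set0 ->
  \sum_(i in S) (\prod_(j in S | j != i) x j) *
     \prod_(l in S | l != i) node_prod_in x S l = \prod_(l in S) node_prod_in x S l.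
Proof.
move=> S0; pose X i : mpoly.mpoly n F := mpoly.mpolyX F (mpoly.mnm1 i).
pose fr : {rmorphism mpoly.mpoly n F -> _} := @tofrac (mpoly.mpoly n F).
have frX : {in S &, injective (fr \o X)}.
  move=> i j _ _ /= /eqP; rewrite /fr /= tofrac_eq => /eqP.
  move=> /(congr1 (mpoly.mcoeff (mpoly.mnm1 j))); rewrite !mpoly.mcoeffXU eqxx.
  by case: eqP => // _ /eqP; rewrite eq_sym oner_eq0.
have eX : \sum_(i in S) (\prod_(j in S | j != i) X j) *
     \prod_(l in S | l != i) node_prod_in X S l = \prod_(l in S) node_prod_in X S l.
  apply/eqP; rewrite -tofrac_eq; apply/eqP; rewrite -/fr rmorph_sum rmorph_prod.
  rewrite (eq_bigr _ (fun l _ => node_prod_in_morph fr X S l)).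
  rewrite -(lagrange_field_prod frX S0); apply: eq_bigr => i _.
  rewrite rmorphM !rmorph_prod; congr (_ * _).
  by apply: eq_bigr => l _; apply: node_prod_in_morph.
pose ph : {rmorphism mpoly.mpoly n F -> A} := mpoly.mmap (in_alg A) x.
have phX i : ph (X i) = x i.
  by rewrite /ph /= /X mpoly.mmapX mpoly.mmap1U.
have linX l : ph (node_prod_in X S l) = node_prod_in x S l.
  by rewrite node_prod_in_morph; apply: eq_bigr => j _; rewrite /= !phX.
have := congr1 ph eX; rewrite rmorph_sum rmorph_prod (eq_bigr _ (fun l _ => linX l)).
move=> <-; apply: eq_bigr => i _; rewrite rmorphM !rmorph_prod.
by congr (_ * _); apply: eq_bigr => l _; rewrite ?phX ?linX.
Qed.

(** * Dyson's constant term identity *)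

Section FiniteAlphabet.
Context (n : nat).

Definition cm_of (f : 'I_n -> nat) : {cmonom 'I_n} :=
  \big[mmul/mone]_i expcmn (ucm i) (f i).

Lemma cm_ofE f y : cm_of f y = f y.
Proof.
have -> : f y = (\sum_i (i == y) * f i)%N.
  by rewrite (bigD1 y) //= eqxx mul1n big1 ?addn0 // => i /negbTE->.
rewrite /cm_of; elim/big_rec2: _ => [|i a b _ <-]; first by rewrite cm1.
by rewrite cmM mpowE.
Qed.

Lemma cm_ofP (u : {cmonom 'I_n}) f : u = cm_of f <-> forall y, u y = f y.
Proof.
split=> [-> y|h]; first by rewrite cm_ofE.
by apply/eqP/cmP=> y; rewrite cm_ofE.
Qed.

Lemma cm_of_eqfun (f g : 'I_n -> nat) : f =1 g -> cm_of f = cm_of g.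
Proof. by move=> fg; apply/cm_ofP=> y; rewrite cm_ofE. Qed.

Lemma cm_ofM f g : mmul (cm_of f) (cm_of g) = cm_of (fun i => f i + g i)%N.
Proof. by apply/cm_ofP=> y; rewrite cmM !cm_ofE. Qed.

Context (F : numFieldType).
Local Notation x := (fun i : 'I_n => xmon F (ucm i)).

Lemma prod_xmon (P : pred 'I_n) (f : 'I_n -> nat) :
  \prod_(i | P i) x i ^+ f i = xmon F (cm_of (fun i => if P i then f i else 0%N)).
Proof.
rewrite big_mkcond /cm_of; elim/big_rec2: _ => [|i v a _ ->]; first by rewrite xmon1.
rewrite -xmonM -xmonX; case: ifP => _ //.
Qed.

End FiniteAlphabet.

Section DysonProduct.
Context (F : numFieldType) (A : comAlgType F) (n : nat) (x : 'I_n -> A).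
Implicit Types (S : {set 'I_n}) (a : 'I_n -> nat).

(** The Laurent polynomial [\prod_(i != j) (1 - x_i / x_j) ^ a_i] over the
    letters of [S], multiplied by the monomial [dyson_exp S a] (defined below)
    that clears its denominators.  Its constant term is thus the coefficient of
    that monomial. *)
Definition dyson S a : A := \prod_(i in S) node_prod_in x S i ^+ a i.

(** A letter with exponent [0] only enters through the factors of the other
    letters. *)
Lemma dyson_remove S a i : i \in S -> a i = 0%N ->
  dyson S a = (\prod_(l in S :\ i) (x i - x l) ^+ a l) * dyson (S :\ i) a.
Proof.
move=> iS ai; rewrite /dyson (big_setD1 i) //= ai expr0 mul1r -big_split /=.
apply: eq_bigr => l lT; rewrite -exprMn; congr (_ ^+ _).
rewrite /node_prod_in (bigD1 i) /=; last first.
  by rewrite iS /=; apply: contraTneq lT => ->; rewrite !inE eqxx.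
congr (_ * _); apply: eq_bigl => j; rewrite !inE.
by rewrite andbAC (andbC (j \in S)).
Qed.

Lemma dyson_split S a : S != set0 -> (forall i, i \in S -> 0 < a i)%N ->
  dyson S a = \sum_(i in S) (\prod_(j in S | j != i) x j) * dyson S (decr i a).
Proof.
move=> S0 apos; have -> : dyson S a =
    \prod_(l in S) node_prod_in x S l * dyson S (fun l => (a l).-1).
  rewrite /dyson -big_split; apply: eq_bigr => l lS /=.
  by rewrite -exprS prednK // apos.
rewrite -(lagrange_prod x S0) mulr_suml; apply: eq_bigr => i iS.
rewrite -mulrA; congr (_ * _).
rewrite /dyson (bigD1 i iS) [in RHS](bigD1 i iS) /= mulrCA -big_split /=.
congr (_ * _); first by rewrite /decr eqxx subn1.
apply: eq_bigr => l /andP[lS /negbTE li]; rewrite -exprS prednK ?apos //.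
by rewrite /decr li subn0.
Qed.

End DysonProduct.

Lemma mul_sub_expand (A : comPzRingType) (a b q : A) d :
  (a - b) * (a ^+ d + q) = a ^+ d.+1 + (q * a + (a ^+ d + q) * - b).
Proof. by rewrite exprS; ring. Qed.

Section Dyson.
Context (F : numFieldType) (n : nat).
Local Notation x := (fun i : 'I_n => xmon F (ucm i)).
Local Notation ser := (series 'I_n F).
Implicit Types (S : {set 'I_n}) (a : 'I_n -> nat) (f g : ser).

Definition degree_lt i d f := forall u, f u != 0 -> (u i < d)%N.

Lemma degree_ltD i d f g : degree_lt i d f -> degree_lt i d g -> degree_lt i d (f + g).
Proof.
move=> hf hg u; rewrite series_coefD; have [->|/hf//] := eqVneq (f u) 0.
by rewrite add0r; apply: hg.
Qed.

Lemma degree_ltN i d f : degree_lt i d f -> degree_lt i d (- f).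
Proof. by move=> hf u; rewrite series_coefN oppr_eq0; apply: hf. Qed.

Lemma degree_ltM i d e f g :
  degree_lt i d f -> degree_lt i e.+1 g -> degree_lt i (d + e) (f * g).
Proof.
move=> hf hg u /series_coefM_neq0[v [w [<- /hf vi /hg wi]]].
by rewrite cmM; lia.
Qed.

Lemma degree_lt_xmon i d (v : {cmonom 'I_n}) : (v i < d)%N -> degree_lt i d (xmon F v).
Proof.
by move=> vd u /=; case: (u =P v) => [->|_]; rewrite ?eqxx.
Qed.

Lemma degree_lt1 i d : degree_lt i d.+1 1.
Proof. by rewrite -xmon1; apply: degree_lt_xmon; rewrite cm1. Qed.

Lemma degree_lt_prod1 (I : Type) (s : seq I) (P : pred I) (h : I -> ser) i :
  (forall j, P j -> degree_lt i 1 (h j)) -> degree_lt i 1 (\prod_(j <- s | P j) h j).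
Proof.
move=> hh; elim/big_rec: _ => [|j f Pj hf]; first exact: degree_lt1.
exact: (degree_ltM (hh j Pj) hf).
Qed.

Lemma degree_lt_exp1 i f m : degree_lt i 1 f -> degree_lt i 1 (f ^+ m).
Proof.
move=> hf; elim: m => [|m IH]; first exact: degree_lt1.
rewrite exprS; exact: (degree_ltM hf IH).
Qed.

Local Notation dyson := (dyson x).

Definition dyson_exp S a : {cmonom 'I_n} :=
  cm_of (fun i => if i \in S then (\sum_(j in S) a j - a i)%N else 0%N).

Definition multinomial S a : F :=
  (\sum_(i in S) a i)`!%:R / \prod_(i in S) (a i)`!%:R.

(** The expansion by decreasing powers of [x_i]. *)
Lemma prod_sub_xmon i (S : {set 'I_n}) a : i \notin S ->
  exists2 q, degree_lt i (\sum_(l in S) a l) q &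
    \prod_(l in S) (x i - x l) ^+ a l = x i ^+ (\sum_(l in S) a l) + q.
Proof.
move=> iS.
have step d l (p q : ser) : l != i -> degree_lt i d q -> p = x i ^+ d + q ->
    exists2 q', degree_lt i d.+1 q' & (x i - x l) * p = x i ^+ d.+1 + q'.
  move=> li hq ->.
  have xl : degree_lt i 1 (- x l).
    by apply/degree_ltN/degree_lt_xmon; rewrite ucmE (negbTE li).
  exists (q * x i + (x i ^+ d + q) * (- x l)); last exact: mul_sub_expand.
  apply: degree_ltD.
    rewrite -addn1; apply: (degree_ltM hq); apply: degree_lt_xmon.
    by rewrite ucmE eqxx.
  rewrite -[d.+1]addn0; apply: degree_ltM xl; apply: degree_ltD.
    by rewrite xmonX; apply: degree_lt_xmon; rewrite mpowE eqxx mul1n.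
  by move=> u /hq; lia.
have steps m d l (p q : ser) : l != i -> degree_lt i d q -> p = x i ^+ d + q ->
    exists2 q', degree_lt i (m + d) q' &
      (x i - x l) ^+ m * p = x i ^+ (m + d) + q'.
  move=> li; elim: m => [|m IH] hq pq; first by exists q; rewrite ?mul1r.
  have [q' hq' e] := IH hq pq; rewrite exprS -mulrA addSn.
  exact: step li hq' e.
elim/big_rec2: _ => [|l d p lS [q hq ->]].
  by exists 0; rewrite ?expr0 ?addr0 // => u; rewrite eqxx.
by apply: steps hq (erefl _); apply: contraNneq iS => <-.
Qed.

(** Good's proof.  If all the exponents are positive, Lagrange's interpolation
    formula expands the product into those where one exponent is lowered, and
    the multinomial coefficients obey the same recursion; a letter with
    exponent [0] only contributes through its highest power. *)
Lemma dyson_coef S a : dyson S a (dyson_exp S a) = multinomial S a.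
Proof.
move: {2}(#|S| + \sum_(i in S) a i)%N (leqnn (#|S| + \sum_(i in S) a i)) => N.
elim: N S a => [|N IH] S a.
  rewrite leqn0 addn_eq0 cards_eq0 => /andP[/eqP-> _].
  rewrite /dyson /multinomial !big_set0 divr1 /dyson_exp series_coef1.
  rewrite (_ : cm_of _ = mone) ?eqxx //; apply/esym/cm_ofP=> y.
  by rewrite cm1 inE.
move=> le.
have [/existsP[i /andP[iS /eqP ai]]|/existsPn pos] :=
    boolP [exists i, (i \in S) && (a i == 0%N)].
  pose T := S :\ i; have iT : i \notin T by rewrite !inE eqxx.
  have sT : \sum_(j in S) a j = \sum_(j in T) a j.
    by rewrite (big_setD1 i) //= ai.
  have -> : multinomial S a = multinomial T a.
    by rewrite /multinomial sT (big_setD1 i iS) /= ai fact0 mul1r.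
  rewrite -IH; last first.
    by move: le; rewrite sT (cardsD1 i) iS -/T add1n addSn ltnS.
  (* Only the leading term in [x_i] reaches the required exponent. *)
  have [q hq eq] := prod_sub_xmon a iT.
  rewrite (dyson_remove _ iS ai) eq.
  rewrite mulrDl series_coefD [X in _ + X](_ : _ = 0) ?addr0; last first.
    apply/eqP; apply: contraT => /series_coefM_neq0[v [w [e /hq vi wn]]].
    have : degree_lt i 1 (dyson T a).
      apply: degree_lt_prod1 => l lT; apply: degree_lt_exp1.
      apply: degree_lt_prod1 => j /andP[jT jl].
      have ne m : m \in T -> m != i by move=> mT; apply: contraNneq iT => <-.
      apply: degree_ltD; last apply: degree_ltN.
        by apply: degree_lt_xmon; rewrite ucmE (negbTE (ne _ jT)).
      by apply: degree_lt_xmon; rewrite ucmE (negbTE (ne _ lT)).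
    move/(_ w wn); move: (congr1 (fun u : {cmonom 'I_n} => u i) e).
    by rewrite /= cmM /dyson_exp cm_ofE iS sT ai subn0 => e1; rewrite ltnS leqn0 => /eqP w0; rewrite -e1 w0 addn0 ltnn in vi.
  rewrite xmonX.
  rewrite (_ : dyson_exp S a =
    mmul (expcmn (ucm i) (\sum_(l in T) a l)) (dyson_exp T a)) ?coef_xmonMl //.
  apply/esym/cm_ofP=> y; rewrite cmM mpowE !cm_ofE sT.
  have [<-|iy] := eqVneq i y; first by rewrite iS (negbTE iT) ai mul1n addn0 subn0.
  by rewrite mul0n /T !inE eq_sym iy.
have [->|S0] := eqVneq S set0.
  rewrite /dyson /multinomial !big_set0 divr1 /dyson_exp series_coef1.
  rewrite (_ : cm_of _ = mone) ?eqxx //; apply/esym/cm_ofP=> y.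
  by rewrite cm1 inE.
have apos i : i \in S -> (0 < a i)%N.
  by move=> iS; have := pos i; rewrite iS lt0n.
have sdec i : i \in S -> (\sum_(j in S) a j = (\sum_(j in S) decr i a j).+1)%N.
  move=> iS; rewrite (bigD1 i) //= [in RHS](bigD1 i) //= /decr eqxx subn1.
  rewrite -{1}(prednK (apos i iS)) addSn; congr (_ + _).+1.
  by apply: eq_bigr => j /andP[_ /negbTE->]; rewrite subn0.
rewrite (dyson_split _ S0 apos) series_coef_sum.
rewrite (eq_bigr (fun i => multinomial S (decr i a))) => [|i iS]; last first.
  rewrite -IH; last by move: le; rewrite (sdec i iS); lia.
  have -> : \prod_(j in S | j != i) x j = xmon F (cm_of (fun j =>
      if (j \in S) && (j != i) then 1%N else 0%N)).
    by rewrite -prod_xmon; apply: eq_bigr => j _; rewrite expr1.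
  rewrite (_ : dyson_exp S a = mmul (cm_of (fun j =>
      if (j \in S) && (j != i) then 1%N else 0%N)) (dyson_exp S (decr i a))).
    by rewrite coef_xmonMl.
  apply/esym/cm_ofP=> y; rewrite cmM !cm_ofE (sdec i iS).
  case yS: (y \in S) => //=.
  have [yi|yi] := eqVneq y i.
    have -> : decr i a y = (a y).-1 by rewrite /decr yi eqxx subn1.
    rewrite yi; have := apos i iS; set t := (\sum_(j in S) _)%N. rewrite /=; lia.
  have dy : decr i a y = a y by rewrite /decr (negbTE yi) subn0.
  have : (decr i a y <= \sum_(j in S) decr i a j)%N by rewrite (bigD1 y) //= leq_addr.
  by rewrite dy; set t := (\sum_(j in S) _)%N => ?; rewrite subSn //= add1n.
have fne (b : 'I_n -> nat) (P : pred 'I_n) : \prod_(i | P i) ((b i)`!)%:R != 0 :> F.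
  by apply/prodf_neq0 => i _; rewrite pnatr_eq0 -lt0n fact_gt0.
have multi_decr i : i \in S -> multinomial S (decr i a) =
    (a i)%:R * ((\sum_(j in S) a j).-1`!%:R / \prod_(j in S) (a j)`!%:R).
  move=> iS; rewrite /multinomial (sdec i iS) /= mulrCA; congr (_ * _).
  rewrite (bigD1 i iS) [in RHS](bigD1 i iS) /= {1}/decr eqxx subn1.
  rewrite [X in _ * X](_ : _ = \prod_(j in S | j != i) (a j)`!%:R); last first.
    by apply: eq_bigr => j /andP[_ /negbTE ji]; rewrite /decr ji subn0.
  rewrite -{3}(prednK (apos i iS)) factS prednK ?apos // natrM -mulrA [in RHS]invfM.
  rewrite mulVKf // pnatr_eq0 -lt0n apos //.
rewrite (eq_bigr _ multi_decr) -mulr_suml -natr_sum mulrA -natrM.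
have [i iS] := set0Pn _ S0.
by rewrite (sdec i iS) /= -factS -(sdec i iS).
Qed.

End Dyson.

(** * The Hankel hyperdeterminant as a symmetric function *)

Section Hankel.
Context (F : numFieldType) (n k : nat).
Local Notation perms := {ffun 'I_(2 * k) -> 'S_n}.
Implicit Types (s : perms).

(** The exponents of the monomial that the permutations [s] contribute to a
    product of [2 k] alternating polynomials. *)
Definition perms_exp s : {cmonom 'I_n} := cm_of (fun i => \sum_j s j i)%N.

Definition perms_sign s : F := (-1) ^+ (\sum_j s j)%N.

(** The Hankel hyperdeterminant before evaluation on an alphabet. *)
Definition hankel_sym : symfun F :=
  (n`!%:R^-1 : F) *: \sum_s perms_sign s *: esf_prod F (perms_exp s).

Lemma perms_signE (A : comAlgType F) s (a : A) :
  (\prod_j (-1) ^+ s j) * a = perms_sign s *: a.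
Proof. by rewrite prodrXr signZ. Qed.

Lemma ev_hankel_sym (A : comAlgType F) (p : nat -> A) :
  ev p hankel_sym = (n`!%:R^-1 : F) *:
    \sum_s perms_sign s *: \prod_i ev p (esf F (\sum_j s j i)%N).
Proof.
rewrite evZ ev_sum; congr (_ *: _); apply: eq_bigr => s _.
rewrite evZ ev_prod; congr (_ *: _); apply: eq_bigr => i _.
by rewrite cm_ofE.
Qed.

Lemma sym_eval_hankel (Y : choiceType) :
  sym_eval Y hankel_sym = hankel_hyperdet F Y n k.
Proof.
rewrite sym_evalE ev_hankel_sym /hankel_hyperdet /hyperdet; congr (_ *: _).
apply: eq_bigr => s _; rewrite perms_signE; congr (_ *: _).
apply: eq_bigr => i _; rewrite ev_esf_elementary; congr (elementary _ _ _).
by apply: eq_bigr => j _; rewrite ffunE.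
Qed.

Local Notation x := (fun i : 'I_n => xmon F (ucm i)).

Lemma vandermonde_power : vandermonde x ^+ (2 * k) =
  \sum_s perms_sign s *: xmon F (perms_exp s).
Proof.
rewrite -alternant_power; apply: eq_bigr => s _; rewrite perms_signE.
by congr (_ *: _); apply: prod_xmon.
Qed.

Let m := (k * (n - 1))%N.

Definition revp : 'S_n := perm (@rev_ord_inj n).

Definition rev_perms s : perms := [ffun j => (s j * revp)%g].

Lemma rev_permsK : involutive rev_perms.
Proof.
move=> s; apply/ffunP=> j; rewrite !ffunE -mulgA.
by apply/permP=> i; rewrite !permM !permE rev_ordK.
Qed.

Lemma rev_perms_exp s :
  mmul (perms_exp s) (perms_exp (rev_perms s)) = cm_of (fun=> 2 * m)%N.
Proof.
rewrite cm_ofM; apply: cm_of_eqfun => i; rewrite -big_split /=.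
rewrite (eq_bigr (fun=> (n - 1)%N)) ?sum_nat_const ?card_ord ?mulnA // => j _.
rewrite ffunE permM permE /=; have := ltn_ord (s j i); lia.
Qed.

Lemma rev_perms_sign s : perms_sign (rev_perms s) = perms_sign s.
Proof.
rewrite /perms_sign -!prodrXr.
rewrite (eq_bigr (fun j => (-1) ^+ s j * (-1) ^+ (revp : bool))); last first.
  by move=> j _; rewrite ffunE odd_permM signr_addb.
rewrite big_split /= prodr_const card_ord.
by rewrite [X in _ * X]exprM sqrr_sign expr1n mulr1.
Qed.

(** Replacing each permutation by its composition with [i -> n - 1 - i] turns
    the sum over the exponents of the alternating polynomial into a convolution
    product, that is into a coefficient of a product of polynomials. *)
Lemma jack_dot_hankel alpha f : jack_dot alpha hankel_sym f =
  n`!%:R^-1 * (vandermonde x ^+ (2 * k) * jack_dual alpha n f) (cm_of (fun=> 2 * m)%N).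
Proof.
rewrite jack_dotZl jack_dot_suml vandermonde_power mulr_suml series_coef_sum.
congr (_ * _); rewrite [RHS](reindex_inj (inv_inj rev_permsK)).
apply: eq_bigr => s _; rewrite jack_dotZl jack_dot_esf_prod rev_perms_sign.
by rewrite -scalerAl series_coefZ -(rev_perms_exp s) mulmC coef_xmonMl.
Qed.

(** The series whose multiples do not contribute to the scalar products with
    the Hankel hyperdeterminant: they form an ideal. *)
Definition annihilated (g : series 'I_n F) : Prop :=
  forall h, (vandermonde x ^+ (2 * k) * (g * h)) (cm_of (fun=> 2 * m)%N) = 0.

Lemma annihilatedD g h : annihilated g -> annihilated h -> annihilated (g + h).
Proof.
move=> hg hh l; rewrite (mulrDl g) (mulrDr (vandermonde x ^+ (2 * k))) series_coefD.
by rewrite hg hh addr0.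
Qed.

Lemma annihilatedM g h : annihilated g -> annihilated (g * h).
Proof. by move=> hg l; rewrite -mulrA; apply: hg. Qed.

Lemma annihilated0 : annihilated 0.
Proof. by move=> h; rewrite (mul0r h) mulr0. Qed.

Lemma power_sum_fin r : power_sum F 'I_n r.+1 = \sum_i x i ^+ r.+1.
Proof.
apply/seriesP=> u; rewrite series_coef_sum -[power_sum _ _ _]mulr1.
rewrite coef_power_sumM // big_finsupp; rewrite big_mkcond; apply: eq_bigr => i _.
rewrite xmonX -[xmon _ _]mulr1 coef_xmonM.
have -> // : (expcmn (ucm i) r.+1 \in divisors u) = (r < u i)%N.
apply/idP/idP=> [/divisorsP[v <-]|/mpow_div//].
by rewrite cmM mpowE eqxx mul1n leq_addr.
Qed.

Lemma jack_dual_esf r : jack_dual k%:R n (esf F r) = multi_complete x (fun=> k) r.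
Proof.
rewrite /jack_dual ev_esf; apply: eq_newton => {}r.
by rewrite power_sum_fin sumrMnl; apply: sign_sign_scale.
Qed.

Lemma vandermonde_node_powers : vandermonde x ^+ (2 * k) = (-1) ^+ ('C(n, 2) * k) *: node_powers x (fun=> k).
Proof.
by rewrite exprM vandermonde_sqr exprMn -exprM signZ /node_powers prodrXl.
Qed.

(** For [r > k (n - 1)] the product of the even power of the Vandermonde with a
    complete function of degree [r], of the letters repeated [k] times, lies in
    the ideal of the [x_i ^ (r + k (n - 1))], whose elements have no monomial
    with all exponents at most [2 k (n - 1)]. *)
Lemma annihilated_esf r : (0 < n)%N -> (m < r)%N ->
  annihilated (jack_dual k%:R n (esf F r)).
Proof.
move=> n0 mr h; rewrite jack_dual_esf mulrA vandermonde_node_powers -!scalerAl series_coefZ.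
have [b ->] := node_powers_complete x (fun=> k) r (Ordinal n0).
rewrite mulr_suml series_coef_sum big1 ?mulr0 // => i _.
rewrite -mulrA xmonX coef_xmonM; case: ifP => // /divisorsP[v].
move/(congr1 (fun u : {cmonom 'I_n} => u i)).
have nk : (n * k = m + k)%N.
  by rewrite /m; case: (n) n0 => // n' _; rewrite subn1 /= mulSn mulnC addnC.
rewrite cmM cm_ofE mpowE eqxx mul1n sum_nat_const card_ord nk.
by clearbody m => e; exfalso; lia.
Qed.

End Hankel.

(** * Restriction to finitely many letters *)

Section ElementaryGenerate.
Context (F : numFieldType) (A B : comAlgType F) (pA : nat -> A) (pB : nat -> B).
Context (m : nat) (J : B -> Prop).
Hypotheses (J0 : J 0) (JD : forall a b, J a -> J b -> J (a + b)).
Hypotheses (JM : forall a b, J a -> J (a * b)).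
Hypotheses (eA : forall r, (m < r)%N -> ev pA (esf F r) = 0).
Hypotheses (eB : forall r, (m < r)%N -> J (ev pB (esf F r))).

Local Notation evA q :=
  (mpoly.mmap (in_alg A) (fun i : 'I_m => ev pA (esf F i.+1)) q).
Local Notation evB q :=
  (mpoly.mmap (in_alg B) (fun i : 'I_m => ev pB (esf F i.+1)) q).

(** The two evaluations of [f] are given by the same polynomial in [e_1], ...,
    [e_m], for the second one modulo an ideal that contains the next elementary
    functions.  The functions with this property form an algebra that contains
    all the [e_r], hence all the power sums, so that it holds for all [f]. *)
Definition esf_polynomial f := exists q : mpoly.mpoly m F,
  ev pA f = evA q /\ J (ev pB f - evB q).

Let esf_polynomialD f g : esf_polynomial f -> esf_polynomial g ->
  esf_polynomial (f + g).
Proof.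
move=> [q [qA qB]] [q' [qA' qB']]; exists (q + q').
rewrite !evD qA qA' !rmorphD; split=> //.
by rewrite opprD addrACA; apply: JD.
Qed.

Let esf_polynomialM f g : esf_polynomial f -> esf_polynomial g ->
  esf_polynomial (f * g).
Proof.
move=> [q [qA qB]] [q' [qA' qB']]; exists (q * q').
rewrite !evM qA qA' !rmorphM; split=> //.
set a := ev pB f; set b := ev pB g; set c := evB q; set d := evB q'.
have -> : a * b - c * d = (a - c) * b + (b - d) * c by rewrite !mulrBl (mulrC d) (mulrC b c) subrKA.
by apply: JD; apply: JM.
Qed.

Let esf_polynomialZ c f : esf_polynomial f -> esf_polynomial (c *: f).
Proof.
move=> [q [qA qB]]; exists (c *: q); rewrite !evZ !mpoly.mmapZ qA !mulr_algl.
by split=> //; rewrite -scalerBr -mulr_algr; apply: JM.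
Qed.

Let esf_polynomial1 : esf_polynomial 1.
Proof. by exists 1; rewrite !ev1 !rmorph1 subrr. Qed.

Let esf_polynomial_esf r : esf_polynomial (esf F r).
Proof.
have [rm|mr] := leqP r m; last first.
  by exists 0; rewrite eA // !rmorph0 subr0; split=> //; apply: eB.
case: r rm => [|r] rm; first by rewrite esf0; apply: esf_polynomial1.
exists (mpoly.mpolyX F (mpoly.mnm1 (Ordinal rm))).
by rewrite !mpoly.mmapX !mpoly.mmap1U subrr.
Qed.

Let esf_polynomial_psf r : esf_polynomial (psf F r.+1).
Proof.
elim/ltn_ind: r => r IH.
rewrite -(sign_signZ (psf F r.+1) r) -[X in _ *: X]signZ.
have := newton_inv (fun i => (-1) ^+ i.-1 * psf F i) r; rewrite -/(esf F r.+1) /= => e.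
rewrite e; apply/esf_polynomialZ/esf_polynomialD; apply: esf_polynomialZ.
  exact: esf_polynomial_esf.
elim/big_rec: _ => [|i f _ IHf].
  by rewrite -(scale0r 1); apply/esf_polynomialZ/esf_polynomial1.
apply: esf_polynomialD IHf; apply: esf_polynomialM; last exact: esf_polynomial_esf.
by rewrite signZ; apply/esf_polynomialZ/IH.
Qed.

Lemma esf_polynomialP f : esf_polynomial f.
Proof.
elim/symfun_ind: f => [|c la f IH].
  by rewrite -(scale0r 1); apply/esf_polynomialZ/esf_polynomial1.
apply: esf_polynomialD IH; apply: esf_polynomialZ.
elim/part_ind: la => [|r la IH]; first exact: esf_polynomial1.
by rewrite -symfunUM; apply: esf_polynomialM IH; apply: esf_polynomial_psf.
Qed.

End ElementaryGenerate.

Section Independence.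
Context (F : numFieldType) (m : nat).
Local Notation P := (mpoly.mpoly m F).

Definition mpoly_series (p : P) : series 'I_m F :=
  mpoly.mmap (in_alg (series 'I_m F)) (fun i => xmon F (ucm i)) p.

HB.instance Definition _ := GRing.RMorphism.copy mpoly_series
  (mpoly.mmap (in_alg (series 'I_m F)) (fun i => xmon F (ucm i))).

Lemma mpoly_seriesE (p : P) (e : mpoly.multinom m) :
  mpoly_series p (cm_of e) = mpoly.mcoeff e p.
Proof.
rewrite /mpoly_series /mpoly.mmap series_coef_sum.
rewrite [p in RHS]mpoly.mpolyE raddf_sum; apply: eq_bigr => v _.
rewrite mulr_algl series_coefZ [RHS]/= mpoly.mcoeffZ mpoly.mcoeffX; congr (_ * _).
rewrite /mpoly.mmap1 prod_xmon /=.
rewrite (_ : (v == e) = (cm_of e == cm_of v)) //; apply/eqP/eqP=> [->|/cm_ofP h]; first exact: cm_of_eqfun.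
by apply/mpoly.mnmP=> i; have := h i; rewrite cm_ofE.
Qed.

Lemma mpoly_series_mesym r :
  mpoly_series (mpoly.mesym m F r) = elementary F 'I_m r.
Proof.
apply/seriesP=> u; pose e := mpoly.Multinom [tuple u i | i < m].
have ue i : e i = u i by rewrite mpoly.multinomE tnth_mktuple.
have {1}-> : u = cm_of e by apply/cm_ofP=> i.
rewrite mpoly_seriesE mpoly.mcoeff_mesym elementaryE /mpoly.mechar.
have -> : mpoly.mdeg e = mdeg u.
  rewrite mpoly.mdegE (eq_bigr (fun i => u i)) // mdegE.
  transitivity (\sum_(i <- finsupp u | (0 < u i)%N) u i)%N.
    rewrite (big_finsupp (fun i => u i)) [RHS]big_mkcond.
    by apply: eq_bigr => i _; case: posnP.
  by rewrite big_mkcond; apply: eq_bigr => i _; case: posnP.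
have -> // : [forall i, e i <= 1]%N = sqfree u.
by apply/forallP/sqfreeP => h i; have := h i; rewrite ue.
Qed.

(** The uniqueness part of the fundamental theorem on symmetric polynomials,
    transported to series by comparison of coefficients. *)
Lemma elementary_independent (q : P) :
  mpoly.mmap (in_alg (series 'I_m F)) (fun i : 'I_m => elementary F 'I_m i.+1) q = 0 ->
  q = 0.
Proof.
move=> q0; apply: mpoly.msym_fundamental_un0; set p := mpoly.comp_mpoly _ _.
suff p0 : mpoly_series p = 0.
  by apply/mpoly.mpolyP=> e; rewrite -mpoly_seriesE p0 mpoly.mcoeff0.
rewrite -q0 /p mpoly.comp_mpolyE raddf_sum /mpoly.mmap; apply: eq_bigr => v _.
rewrite /= /mpoly_series mpoly.mmapZ; congr (_ * _).
rewrite -/(mpoly_series _) rmorph_prod; apply: eq_bigr => i _.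
by rewrite rmorphXn tnth_mktuple /= mpoly_series_mesym.
Qed.

Lemma elementary_eq0 r : (m < r)%N -> elementary F 'I_m r = 0.
Proof.
move=> mr; apply/seriesP=> u; rewrite elementaryE; case: eqP => //= ur.
case: sqfreeP => // u1; move: mr; rewrite ltnNge => /negP[].
rewrite -ur mdegE -[X in (_ <= X)%N]card_ord -sum1_card.
apply: (@leq_trans (\sum_(i <- finsupp u) 1)%N); first exact: leq_sum.
rewrite !sum1_size; apply: uniq_leq_size (fset_uniq _) _ => i _.
exact: mem_index_enum.
Qed.

Definition to_nat_letters (u : {cmonom 'I_m}) : {cmonom nat} :=
  \big[mmul/mone]_(i < m) expcmn (ucm (val i)) (u i).

Lemma to_nat_lettersE u z :
  to_nat_letters u z = (\sum_(i < m) (val i == z) * u i)%N.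
Proof.
rewrite /to_nat_letters; elim/big_rec2: _ => [|i a b _ <-]; first by rewrite cm1.
by rewrite cmM mpowE.
Qed.

Lemma to_nat_letters_val u (i : 'I_m) : to_nat_letters u (val i) = u i.
Proof.
rewrite to_nat_lettersE (bigD1 i) //= eqxx mul1n big1 ?addn0 // => j ji.
by rewrite (inj_eq val_inj) (negbTE ji).
Qed.

Lemma to_nat_letters_out u z : (m <= z)%N -> to_nat_letters u z = 0%N.
Proof.
move=> mz; rewrite to_nat_lettersE big1 // => i _; case: eqP => // iz.
by have := ltn_ord i; rewrite -[nat_of_ord i]/(val i) iz ltnNge mz.
Qed.

Lemma to_nat_letters_div u (i : 'I_m) r :
  to_nat_letters (divcm u (expcmn (ucm i) r)) =
  divcm (to_nat_letters u) (expcmn (ucm (val i)) r).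
Proof.
apply/eqP/cmP=> z; rewrite divcmE mpowE; case: (ltnP z m) => zm.
  rewrite -[z]/(val (Ordinal zm)) !to_nat_letters_val divcmE mpowE.
  by rewrite (inj_eq val_inj).
by rewrite !to_nat_letters_out.
Qed.

Lemma big_finsupp_nat (G : nat -> F) r u : (0 < r)%N ->
  \sum_(z <- finsupp (to_nat_letters u) | (r <= to_nat_letters u z)%N) G z =
  \sum_(i <- finsupp u | (r <= u i)%N) G (val i).
Proof.
move=> r0; rewrite -big_filter -[RHS]big_filter -(big_map val xpredT).
apply: perm_big; apply: uniq_perm.
- exact/filter_uniq/fset_uniq.
- rewrite (map_inj_uniq val_inj); exact/filter_uniq/fset_uniq.
move=> z; rewrite mem_filter; apply/andP/mapP=> [[rz zs]|[i]].
  have zm : (z < m)%N.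
    by rewrite ltnNge; apply/negP=> mz; rewrite to_nat_letters_out // leqNgt r0 in rz.
  exists (Ordinal zm) => //; rewrite mem_filter.
  have <- := to_nat_letters_val u (Ordinal zm); rewrite [val _]/= rz /=.
  by rewrite -cmE_neq0 -to_nat_letters_val [val _]/= cmE_neq0.
rewrite mem_filter => /andP[ri iu] ->; rewrite to_nat_letters_val ri.
by rewrite -cmE_neq0 to_nat_letters_val cmE_neq0.
Qed.

Lemma ev_restrict f (u : {cmonom 'I_m}) :
  ev (power_sum F 'I_m) f u = ev (power_sum F nat) f (to_nat_letters u).
Proof.
elim/symfun_ind: f => [|c la f IH]; first by rewrite !ev0.
rewrite !evD !evZ !series_coefD !series_coefZ IH; congr (_ * _ + _); clear f IH.
elim/part_ind: la u => [|r la IH] u.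
  rewrite !ev1 !series_coef1; have -> // : (u == mone) = (to_nat_letters u == mone).
  apply/eqP/eqP=> [->|e].
    by apply/eqP/cmP=> z; rewrite to_nat_lettersE big1 ?cm1 // => i _; rewrite cm1 muln0.
  by apply/eqP/cmP=> i; rewrite -to_nat_letters_val e !cm1.
rewrite -symfunUM !evM !(ev_psf _ r) !coef_power_sumM //.
rewrite (big_finsupp_nat (fun z => ev (power_sum F nat) << la >>
   (divcm (to_nat_letters u) (expcmn (ucm z) r.+1)))) //.
by apply: eq_bigr => i _; rewrite IH to_nat_letters_div.
Qed.

End Independence.

(** On [m = k (n - 1)] letters the functions [e_1], ..., [e_m] are independent
    and the next ones vanish: a function that is zero there is a combination of
    multiples of the [e_r] with [r > m], and all of these are orthogonal to the
    hyperdeterminant. *)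
Lemma jack_dot_hankel_vanish (F : numFieldType) n k (f : symfun F) :
    (0 < n)%N -> ev (power_sum F 'I_(k * (n - 1))) f = 0 ->
  jack_dot k%:R (hankel_sym F n k) f = 0.
Proof.
move=> n0 f0; set m := (k * (n - 1))%N in f0 *.
have [|||||q [qA]] := @esf_polynomialP F _ _ (power_sum F 'I_m)
  (fun r => ((-1) ^+ r.-1 * k%:R) *: power_sum F 'I_n r) m
  (annihilated (n := n) k) _ _ _ _ _ f.
- exact: annihilated0.
- exact: annihilatedD.
- exact: annihilatedM.
- by move=> r mr; rewrite ev_esf_elementary elementary_eq0.
- by move=> r mr; apply: annihilated_esf.
rewrite f0 in qA; have q0 : q = 0.
  apply: elementary_independent; rewrite qA.
  by apply: eq_bigr => v _; congr (_ * _); apply: eq_bigr => i _;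
     rewrite ev_esf_elementary.
rewrite q0 rmorph0 subr0 jack_dot_hankel -/(jack_dual k%:R n f) => /(_ 1) e.
by rewrite -[jack_dual _ _ _]mulr1 e mulr0.
Qed.

(** * Coefficients of the products of power sums *)

Section Shape.
Context (Y : choiceType).
Implicit Types (u v : {cmonom Y}).

Definition exponents u : seq nat := [seq u y | y <- finsupp u].

Lemma size_exponents u : size (exponents u) = #|` finsupp u|%fset.
Proof. by rewrite size_map. Qed.

Lemma finsupp_div_eq u y r : u y = r -> finsupp (divcm u (expcmn (ucm y) r)) = (finsupp u `\ y)%fset.
Proof.
move=> uy; apply/fsetP=> z; rewrite !inE -!cmE_neq0 divcmE mpowE (eq_sym y z).
by have [->|_] := eqVneq z y; rewrite ?mul1n ?uy ?subnn ?subn0 ?eqxx.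
Qed.

Lemma finsupp_div_lt u y r : (r < u y)%N -> finsupp (divcm u (expcmn (ucm y) r)) = finsupp u.
Proof.
move=> uy; apply/fsetP=> z; rewrite -!cmE_neq0 divcmE mpowE.
by have [<-|_] := eqVneq y z; rewrite ?mul1n ?subn0 //; lia.
Qed.

Lemma exponents_div u y r : y \in finsupp u -> u y = r ->
  perm_eq (exponents u) (r :: exponents (divcm u (expcmn (ucm y) r))).
Proof.
move=> yu uy; rewrite /exponents finsupp_div_eq //.
rewrite (perm_trans (y := [seq u z | z <- y :: (finsupp u `\ y)%fset])) //.
  apply: perm_map; apply: uniq_perm; rewrite ?fset_uniq //= ?fset_uniq ?andbT.
    by rewrite !inE eqxx.
  by move=> z; rewrite !inE; have [->|] := eqVneq z y.
rewrite /= uy perm_cons.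
have -> // : [seq u z | z <- (finsupp u `\ y)%fset] =
  [seq divcm u (expcmn (ucm y) r) z | z <- (finsupp u `\ y)%fset].
apply/eq_in_map => z; rewrite !inE => /andP[zy _].
by rewrite divcmE mpowE eq_sym (negbTE zy) subn0.
Qed.

End Shape.

Definition mon_of (la : intpart) : {cmonom nat} :=
  \big[mmul/mone]_(i < size la) expcmn (ucm (val i)) (nth 0%N la i).

Lemma mon_ofE la z : mon_of la z = nth 0%N la z.
Proof.
have -> : mon_of la z = (\sum_(i < size la) (val i == z) * nth 0%N la i)%N.
  rewrite /mon_of; elim/big_rec2: _ => [|i a b _ <-]; first by rewrite cm1.
  by rewrite cmM mpowE.
have [zs|zs] := ltnP z (size la).
  rewrite (bigD1 (Ordinal zs)) //= eqxx mul1n big1 ?addn0 // => i.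
  by rewrite -val_eqE => /negbTE /= ->.
rewrite nth_default // big1 // => i _; case: eqP => // iz.
by have := ltn_ord i; rewrite -[nat_of_ord i]/(val i) iz ltnNge zs.
Qed.

Lemma exponents_mon_of la : perm_eq (exponents (mon_of la)) la.
Proof.
have fs : perm_eq (finsupp (mon_of la)) (iota 0 (size la)).
  apply: uniq_perm; rewrite ?fset_uniq ?iota_uniq // => z.
  rewrite -cmE_neq0 mon_ofE mem_iota /= add0n.
  have [zs|zs] := ltnP z (size la); last by rewrite nth_default.
  by rewrite -lt0n; apply: parts_gt0; apply: mem_nth.
rewrite (perm_trans (perm_map _ fs)) //.
rewrite (eq_map (g := nth 0%N la)) ?map_nth_iota0 ?take_size //.
exact: mon_ofE.
Qed.

Lemma mdeg_exponents (Y : choiceType) (u : {cmonom Y}) : mdeg u = sumn (exponents u).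
Proof. by rewrite mdegE sumnE big_map. Qed.

Lemma mdeg_mon_of la : mdeg (mon_of la) = sumn la.
Proof. by rewrite mdeg_exponents (perm_sumn (exponents_mon_of la)). Qed.

Lemma perm_mmul (la mu : intpart) : perm_eq (mmul la mu) (la ++ mu).
Proof. exact: partMP. Qed.

Section PowerSumCoefficients.
Context (F : numFieldType) (Y : choiceType).
Implicit Types (u : {cmonom Y}) (la : intpart).
Local Notation psY la := (psi (power_sum F Y) la).

Lemma psi_cons r la u : psY (mmul (part_single r) la) u =
  \sum_(y <- finsupp u | (r < u y)%N) psY la (divcm u (expcmn (ucm y) r.+1)).
Proof.
rewrite -!ev_basis -symfunUM evM (ev_psf _ r) coef_power_sumM //.
Qed.

Lemma psi_nil u : psY mone u = (u == mone)%:R.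
Proof. by rewrite /psi big_nil. Qed.

Lemma psi_coef_ge0 la u : 0 <= psY la u.
Proof.
elim/part_ind: la u => [|r la IH] u; first by rewrite psi_nil.
by rewrite psi_cons; apply: sumr_ge0.
Qed.

Lemma psi_cons_neq0 r la u : psY (mmul (part_single r) la) u != 0 ->
  exists y, [/\ y \in finsupp u, (r < u y)%N &
    psY la (divcm u (expcmn (ucm y) r.+1)) != 0].
Proof.
rewrite psi_cons => h; apply: contrapT => no; move/negP: h; apply.
rewrite big_seq_cond big1 // => y /andP[yu ry]; apply/eqP.
by apply: contraT => h; case: no; exists y.
Qed.

Lemma psi_coef_mdeg la u : psY la u != 0 -> mdeg u = sumn la.
Proof.
elim/part_ind: la u => [|r la IH] u.
  by rewrite psi_nil; case: (u =P mone) => [->|]; rewrite ?mdeg1 // eqxx.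
case/psi_cons_neq0 => y [yu ry /IH e].
by rewrite (mdeg_divcm (mpow_div ry)) mdeg_mpow e sumn_partM /= addn0.
Qed.

(** The monomials of a product of [l] power sums involve at most [l] letters,
    and those with [l] letters have distinct letters for distinct factors. *)
Lemma psi_coef_size la u : psY la u != 0 ->
  (size (exponents u) <= size la)%N /\
  (size (exponents u) = size la -> perm_eq (exponents u) la).
Proof.
elim/part_ind: la u => [|r la IH] u.
  rewrite psi_nil; case: (u =P mone) => [->|]; last by rewrite eqxx.
  by rewrite /exponents mdom1.
case/psi_cons_neq0 => y [yu ry /IH[le eq]].
rewrite size_partM add1n.
case: (ltngtP r.+1 (u y)) ry => [ruy||uy] // _.
  have es : size (exponents u) = size (exponents (divcm u (expcmn (ucm y) r.+1))).
    by rewrite !size_exponents finsupp_div_lt.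
  by rewrite es; split; [apply: leqW|move=> e; rewrite e ltnn in le].
have pe := exponents_div yu (esym uy).
rewrite (perm_size pe) /=; split; first by [].
move=> [/eq pe']; apply: (perm_trans pe); rewrite perm_sym.
by rewrite perm_sort perm_cons perm_sym.
Qed.

Lemma psi_coef_gt0 la u : perm_eq (exponents u) la -> 0 < psY la u.
Proof.
elim/part_ind: la u => [|r la IH] u.
  move=> /perm_size /eqP; rewrite psi_nil size_exponents cardfs_eq0 => /eqP u0.
  have -> : u = mone by apply/eqP/cmP=> y; rewrite cm1; apply/eqP; rewrite cmE_eq0 u0.
  by rewrite eqxx ltr01.
move/perm_trans=> /(_ _ (perm_mmul _ _)) pe.
have : r.+1 \in exponents u by rewrite (perm_mem pe) inE eqxx.
case/mapP=> y yu uy; rewrite psi_cons.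
rewrite (big_rem y) //= -uy leqnn; apply: ltr_wpDr.
  by apply: sumr_ge0 => z _; apply: psi_coef_ge0.
apply: IH; rewrite -(perm_cons r.+1) -(permPr pe) perm_sym.
exact: exponents_div.
Qed.

End PowerSumCoefficients.

Section Injectivity.
Context (F : numFieldType).
Implicit Types (f g : symfun F) (la mu : intpart).

Definition part_coef f mu : F := sym_eval nat f (mon_of mu).

Lemma part_coefD f g mu : part_coef (f + g) mu = part_coef f mu + part_coef g mu.
Proof. by rewrite /part_coef !sym_evalE evD. Qed.

Lemma part_coefZ c f mu : part_coef (c *: f) mu = c * part_coef f mu.
Proof. by rewrite /part_coef !sym_evalE evZ. Qed.

Lemma part_coef0 mu : part_coef 0 mu = 0.
Proof. by rewrite -(scale0r 0) part_coefZ mul0r. Qed.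

Lemma part_coef_sum (I : Type) (s : seq I) (P : pred I) (h : I -> symfun F) mu :
  part_coef (\sum_(i <- s | P i) h i) mu = \sum_(i <- s | P i) part_coef (h i) mu.
Proof. by rewrite /part_coef sym_evalE ev_sum series_coef_sum; under eq_bigr do rewrite -sym_evalE. Qed.

Lemma part_coefE f mu :
  part_coef f mu = \sum_(la <- msupp f) mcoeff la f * psi (power_sum F nat) la (mon_of mu).
Proof. by rewrite /part_coef sym_evalE evE series_coef_sum. Qed.

(** The products of power sums are linearly independent: a longest index in
    the support of [f] contributes alone to the coefficient of its own
    monomial. *)
Lemma part_coef_inj f : (forall mu, part_coef f mu = 0) -> f = 0.
Proof.
move=> h; apply/eqP; apply: contraT; rewrite -msupp_eq0 => f0.
have [la laf lmax] : exists2 la, la \in msupp f &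
    forall mu, mu \in msupp f -> (size mu <= size la)%N.
  have [la0 la0f] := fset0Pn _ f0.
  pose P j := has (fun la : intpart => size la == j) (msupp f).
  have P0 : exists j, P j by exists (size la0); apply/hasP; exists la0.
  have Pb j : P j -> (j <= \max_(la <- msupp f) size la)%N.
    by case/hasP=> la laf /eqP <-; apply: leq_bigmax_seq.
  case: (ex_maxnP P0 Pb) => j /hasP[la laf /eqP <-] jmax.
  by exists la => // mu muf; apply: jmax; apply/hasP; exists mu.
have := h la; rewrite part_coefE (big_fsetD1 la) //= big_seq big1 => [|mu].
  rewrite addr0 => /eqP; rewrite mulf_eq0 mcoeff_eq0 laf /=.
  by rewrite (negbTE (lt0r_neq0 (psi_coef_gt0 F (exponents_mon_of la)))).
rewrite !inE => /andP[mula muf]; apply/eqP; rewrite mulf_eq0; apply/orP; right.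
apply: contraT => /psi_coef_size.
have pe := exponents_mon_of la; rewrite (perm_size pe) => -[le eq].
have e : size la = size mu by apply/eqP; rewrite eqn_leq le lmax.
move: (eq e); rewrite (permPl pe) => /intpartP lamu.
by rewrite lamu eqxx in mula.
Qed.

Lemma part_coef_sumn f mu : part_coef f mu != 0 ->
  exists2 la, la \in msupp f & sumn mu = sumn la.
Proof.
move=> h; apply: contrapT => no; move/negP: h; apply; rewrite part_coefE.
rewrite big_seq big1 // => la laf; apply/eqP; rewrite mulf_eq0; apply/orP; right.
apply: contraT => /psi_coef_mdeg; rewrite mdeg_mon_of => e.
by case: no; exists la.
Qed.

End Injectivity.

(** * Dominance order and Jack polynomials *)

Section Dominance.
Implicit Types la mu nu : intpart.

Lemma size_le_sumn la : (size la <= sumn la)%N.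
Proof.
elim/part_ind: la => [|r la IH] //.
by rewrite size_partM sumn_partM /= addn0; lia.
Qed.

Lemma part_le_sumn la i : i \in (la : seq nat) -> (i <= sumn la)%N.
Proof. by move=> h; rewrite (perm_sumn (perm_to_rem h)) /= leq_addr. Qed.

Definition bounded_parts M : seq intpart := undup (pmap insub (flatten
  [seq [seq [seq val i | i <- tval t] | t : j.-tuple 'I_M.+1]
     | j <- iota 0 M.+1])).

Lemma mem_bounded_parts M la : (sumn la <= M)%N -> la \in bounded_parts M.
Proof.
move=> laM; rewrite mem_undup mem_pmap; apply/mapP; exists (la : seq nat); last first.
  by rewrite (valK la).
apply/flatten_mapP; exists (size la).
  by rewrite mem_iota /= ltnS (leq_trans (size_le_sumn la)).
pose t : (size la).-tuple 'I_M.+1 := map_tuple inord (in_tuple la).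
apply/mapP; exists t; first by rewrite mem_enum.
rewrite /t /= -map_comp -[LHS]map_id; apply/eq_in_map=> i ila /=.
by rewrite inordK // ltnS (leq_trans (part_le_sumn ila)).
Qed.

(** A quantity that increases strictly with the dominance order, to proceed by
    induction on it. *)
Definition weight la := (\sum_(j < (sumn la).+1) sumn (take j la))%N.

Lemma sumn_take_over la j : (sumn la <= j)%N -> take j la = la.
Proof. by move=> h; apply: take_oversize; apply: leq_trans (size_le_sumn la) h. Qed.

Lemma dom_lt_weight mu la : dom_lt mu la -> (weight mu < weight la)%N.
Proof.
move=> [[sm le] ne]; rewrite /weight sm.
have [/existsP[j jlt]|/existsPn all] :=
    boolP [exists j : 'I_(sumn la).+1, (sumn (take j mu) < sumn (take j la))%N].
  rewrite (bigD1 j) //= [X in (_ < X)%N](bigD1 j) //= -addSn.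
  by apply: leq_add => //; apply: leq_sum => i _.
case: ne; have eq j : sumn (take j mu) = sumn (take j la).
  have [jl|jl] := leqP j (sumn la).
    have := all (Ordinal (jl : (j < (sumn la).+1)%N)); rewrite -leqNgt /= => ge.
    by apply/eqP; rewrite eqn_leq le ge.
  by rewrite !sumn_take_over ?sm // ltnW.
have nth_eq (s t : seq nat) : 0%N \notin s -> 0%N \notin t ->
    (forall j, sumn (take j s) = sumn (take j t)) -> s = t.
  elim: s t => [|a s IH] [|b t] //=.
  - by move=> _; rewrite inE negb_or eq_sym => /andP[/eqP b0 _] /(_ 1%N) /=; lia.
  - by rewrite inE negb_or eq_sym => /andP[/eqP b0 _] _ /(_ 1%N) /=; lia.
  rewrite !inE !negb_or => /andP[_ s0] /andP[_ t0] h.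
  have ab : a = b by have := h 1%N; rewrite /= !take0 /= !addn0.
  congr (_ :: _) => //; apply: IH => // j.
  by have := h j.+1; rewrite /= ab => /addnI.
by apply: val_inj; apply: nth_eq; rewrite ?parts_neq0.
Qed.

Lemma dom_lt_size mu la : dom_lt mu la -> (size la <= size mu)%N.
Proof.
move=> [[sm le] _]; rewrite leqNgt; apply/negP=> lt.
have := le (size mu); rewrite take_size sm -{1}(cat_take_drop (size mu) la).
rewrite sumn_cat; have : drop (size mu) la != [::].
  by rewrite -size_eq0 size_drop subn_eq0 -ltnNge.
case e: (drop (size mu) la) => [//|a s] _ /=.
have : a \in (la : seq nat).
  by rewrite -(cat_take_drop (size mu) la) mem_cat e inE eqxx orbT.
by move/parts_gt0; lia.
Qed.

Lemma dom_lt_head mu la : dom_lt mu la -> (head 0 mu <= head 0 la)%N.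
Proof.
move=> [[_ le] _]; have := le 1%N.
by case: (la : seq nat) (mu : seq nat) => [|a s] [|b t] //=; rewrite ?take0 /=; lia.
Qed.

Lemma dom_lt_sumn mu la : dom_lt mu la -> sumn mu = sumn la.
Proof. by case=> -[]. Qed.

Lemma dom_lt_irrefl la : ~ dom_lt la la.
Proof. by case. Qed.

Lemma rectP m n la : sumn la = (m * n)%N -> (size la <= m)%N ->
  (head 0 la <= n)%N -> (0 < n)%N -> la = nseq m n :> seq nat.
Proof.
move=> sla sz hd n0.
have all_le i : i \in (la : seq nat) -> (i <= n)%N.
  move=> ila; apply: leq_trans hd; have := parts_sorted la.
  case: (la : seq nat) ila => //= a s; rewrite inE => /orP[/eqP-> //|is_].
  by rewrite (path_sortedE geq_trans) => /andP[/allP/(_ i is_)].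
elim: (la : seq nat) m sla sz all_le => [|a s IH] m /=.
  by case: m => // m /esym/eqP; rewrite muln_eq0 /= => /eqP n00; rewrite n00 in n0.
case: m => // m sla sz h.
have an : (a <= n)%N by apply: h; rewrite inE eqxx.
have sle : (sumn s <= size s * n)%N.
  have : forall i, i \in s -> (i <= n)%N by move=> i is_; apply: h; rewrite inE is_ orbT.
  elim: (s) => //= b t IHt ht; rewrite mulSn leq_add ?ht ?inE ?eqxx //.
  by apply: IHt => i it; apply: ht; rewrite inE it orbT.
have smn : (size s * n <= m * n)%N by apply: leq_mul.
have [ean es] : a = n /\ sumn s = (m * n)%N by move: sla; rewrite mulSn; lia.
rewrite ean; congr (_ :: _); apply: IH => // i is_; apply: h.
by rewrite inE is_ orbT.
Qed.

End Dominance.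

Section Jack.
Context (F : numFieldType).
Implicit Types (f g : symfun F) (la mu nu : intpart).

Lemma monomial_coef la (Y : choiceType) (u : {cmonom Y}) :
  monomial F Y la u = (sort geq (exponents u) == la)%:R.
Proof. by []. Qed.

Lemma sort_mon_of la : sort geq (exponents (mon_of la)) = la :> seq nat.
Proof.
apply: (sorted_eq geq_trans geq_anti); rewrite ?sort_sorted ?parts_sorted //.
  exact: geq_total.
by rewrite perm_sort exponents_mon_of.
Qed.

Lemma unitriangular_part_coef la f : unitriangular la f ->
  part_coef f la = 1 /\ forall mu, part_coef f mu != 0 -> mu = la \/ dom_lt mu la.
Proof.
move=> [u udom uE].
have fE mu : part_coef f mu = (mu == la)%:R + mcoeff mu u.
  rewrite /part_coef uE series_coefD monomial_coef sort_mon_of; congr (_ + _).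
  rewrite series_coef_sum; have [muu|muu] := boolP (mu \in msupp u).
    rewrite (big_fsetD1 mu muu) series_coefZ monomial_coef sort_mon_of eqxx.
    rewrite mulr1 big_seq big1 => [|nu]; first exact: addr0.
    rewrite !inE series_coefZ monomial_coef sort_mon_of => /andP[ne _].
    by rewrite (inj_eq val_inj) eq_sym (negbTE ne) mulr0.
  rewrite mcoeff_outdom // big_seq big1 // => nu nuu.
  rewrite series_coefZ monomial_coef sort_mon_of (inj_eq val_inj).
  by case: eqP => [e|_]; rewrite ?mulr0 //; rewrite e nuu in muu.
split=> [|mu].
  rewrite fE eqxx; have [/udom/dom_lt_irrefl//|lau] := boolP (la \in msupp u).
  by rewrite mcoeff_outdom // addr0.
rewrite fE; case: (mu =P la) => [->|_]; first by left.
by rewrite add0r mcoeff_neq0 => /udom; right.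
Qed.

Lemma unitriangular_vanish la f m : unitriangular la f -> (m < size la)%N ->
  ev (power_sum F 'I_m) f = 0.
Proof.
move=> [u udom uE] mla; apply/seriesP=> v; rewrite ev_restrict -sym_evalE uE.
have szv : (size (exponents (to_nat_letters v)) <= m)%N.
  rewrite size_exponents -[X in (_ <= X)%N](size_iota 0).
  apply: uniq_leq_size (fset_uniq _) _ => z; rewrite -cmE_neq0 mem_iota /= add0n.
  by rewrite ltnNge; apply: contra => mz; rewrite to_nat_letters_out.
have no nu : (m < size nu)%N -> monomial F nat nu (to_nat_letters v) = 0.
  move=> mnu; rewrite monomial_coef; case: eqP => // e.
  by move: szv; rewrite -(size_sort geq) e leqNgt mnu.
rewrite series_coefD no // series_coef_sum add0r big_seq big1 // => nu /udom d.
by rewrite series_coefZ no ?mulr0 // (leq_trans mla) // dom_lt_size.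
Qed.

Variables (alpha : F) (P : intpart -> symfun F).
Hypotheses (a0 : alpha != 0) (hP : is_jack alpha P).

Let triP la : unitriangular la (P la). Proof. exact: hP.2. Qed.

(** Elimination: subtracting multiples of Jack polynomials cancels the
    coefficients of the largest weight and creates only smaller ones. *)
Lemma jack_span_bounded M W f :
    (forall mu, part_coef f mu != 0 -> (sumn mu <= M)%N /\ (weight mu < W)%N) ->
  exists a : intpart -> F, f = \sum_(mu <- bounded_parts M) a mu *: P mu.
Proof.
elim: W f => [|W IH] f hf.
  exists (fun=> 0); rewrite big1 => [|mu _]; last exact: scale0r.
  by apply: part_coef_inj => mu; apply/eqP; apply: contraT => /hf[].
pose top : symfun F := \sum_(mu <- bounded_parts M)
  (if weight mu == W then part_coef f mu else 0) *: P mu.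
have [|a fa] := IH (f + (-1) *: top).
  move=> nu nz.
  have ctop : part_coef top nu = \sum_(mu <- bounded_parts M)
      (if weight mu == W then part_coef f mu else 0) * part_coef (P mu) nu.
    by rewrite part_coef_sum; apply: eq_bigr => mu _; rewrite part_coefZ.
  have lev mu : weight mu = W -> part_coef f mu != 0 -> part_coef (P mu) nu != 0 ->
      nu = mu \/ (sumn nu <= M)%N /\ (weight nu < W)%N.
    move=> wmu /hf[muM _] /(unitriangular_part_coef (triP mu)).2[|d]; first by left.
    by right; rewrite (dom_lt_sumn d) -wmu dom_lt_weight.
  have [nuW|nuW] := eqVneq (weight nu) W.
    move: nz; have fctop : part_coef top nu = part_coef f nu.
      have [fnu|fnu] := eqVneq (part_coef f nu) 0.
        rewrite fnu ctop big1 // => mu _; case: eqP => [wmu|_]; last exact: mul0r.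
        apply/eqP; rewrite mulf_eq0; apply: contraT; rewrite negb_or.
        case/andP=> fmu Pmu; case: (lev mu wmu fmu Pmu) => [e|[_]].
          by rewrite -e fnu eqxx in fmu.
        by rewrite nuW ltnn.
      have nuL : nu \in bounded_parts M by apply: mem_bounded_parts; case: (hf nu fnu).
      rewrite ctop (bigD1_seq nu) ?undup_uniq //= nuW eqxx.
      rewrite (unitriangular_part_coef (triP nu)).1 mulr1 big1 ?addr0 // => mu munu.
      case: eqP => [wmu|_]; last exact: mul0r.
      apply/eqP; rewrite mulf_eq0; apply: contraT; rewrite negb_or.
      case/andP=> fmu Pmu; case: (lev mu wmu fmu Pmu) => [e|[_]].
        by rewrite e eqxx in munu.
      by rewrite nuW ltnn.
    by rewrite part_coefD part_coefZ fctop mulN1r subrr eqxx.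
  have [fnu|/hf[nuM]] := eqVneq (part_coef f nu) 0; last first.
    by rewrite ltnS leq_eqVlt (negbTE nuW).
  move: nz; rewrite part_coefD part_coefZ fnu add0r mulN1r oppr_eq0 ctop => nz.
  apply: contrapT => no; move/negP: nz; apply; rewrite big1 // => mu _.
  case: eqP => [wmu|_]; last exact: mul0r.
  apply/eqP; rewrite mulf_eq0; apply: contraT; rewrite negb_or.
  case/andP=> fmu Pmu; case: (lev mu wmu fmu Pmu) => [e|//].
  by rewrite e wmu eqxx in nuW.
exists (fun mu => a mu + (if weight mu == W then part_coef f mu else 0)).
under eq_bigr do rewrite scalerDl.
rewrite big_split /= -fa -/top scaleN1r.
by rewrite subrK.
Qed.

Lemma jack_span f M : (forall mu, part_coef f mu != 0 -> (sumn mu <= M)%N) ->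
  exists a : intpart -> F, f = \sum_(mu <- bounded_parts M) a mu *: P mu.
Proof.
move=> hf; apply: (@jack_span_bounded M
  (\max_(mu <- bounded_parts M) weight mu).+1) => mu /hf muM.
by split=> //; rewrite ltnS leq_bigmax_seq // mem_bounded_parts.
Qed.

(** An isotropic Jack polynomial would be orthogonal to all Jack polynomials,
    which span, while the scalar product is nondegenerate. *)
Lemma jack_norm_neq0 la : jack_dot alpha (P la) (P la) != 0.
Proof.
apply/eqP=> e; have P0 : P la = 0.
  apply: (jack_dot_nondegenerate a0) => f.
  have [|a ->] := @jack_span f (\max_(mu <- msupp f) sumn mu)%N.
    by move=> mu /part_coef_sumn[nu nuf ->]; apply: leq_bigmax_seq.
  rewrite jack_dot_sumr big1 // => mu _; rewrite jack_dotZr.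
  have [<-|/eqP ne] := eqVneq la mu; first by rewrite e mulr0.
  by rewrite hP.1 ?mulr0.
have := (unitriangular_part_coef (triP la)).1.
by rewrite P0 part_coef0 => /eqP; rewrite eq_sym oner_eq0.
Qed.

(** In the expansion [f = \sum_mu a_mu P_mu], going down the dominance order
    shows [a_mu = 0] for the indices in the up-set [bad], since the coefficient
    of the monomial function of index [mu] is then [a_mu] itself; for the
    remaining [mu != la] the orthogonality gives [a_mu = 0]. *)
Lemma jack_characterization la f (bad : intpart -> Prop) :
    (forall mu nu, dom_lt mu nu -> bad mu -> bad nu) ->
    (forall mu, bad mu -> part_coef f mu = 0) ->
    (forall mu, mu <> la -> ~ bad mu -> jack_dot alpha f (P mu) = 0) ->
    ~ bad la ->
  f = part_coef f la *: P la.
Proof.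
move=> bad_up bad0 dot0 nbad.
pose M := (\max_(mu <- msupp f) sumn mu)%N.
have fM mu : part_coef f mu != 0 -> (sumn mu <= M)%N.
  by case/part_coef_sumn=> nu nuf ->; apply: leq_bigmax_seq.
have [a fa] := jack_span fM.
have uL : uniq (bounded_parts M) by exact: undup_uniq.
(* Descending induction on the weight; [W] bounds the distance to the top. *)
have abad W mu : mu \in bounded_parts M -> bad mu ->
    (\max_(nu <- bounded_parts M) weight nu < weight mu + W)%N -> a mu = 0.
  elim: W mu => [|W IH] mu muL bmu.
    by rewrite addn0 ltnNge leq_bigmax_seq.
  move=> lt; have := bad0 mu bmu; rewrite fa part_coef_sum (bigD1_seq mu) //=.
  rewrite part_coefZ (unitriangular_part_coef (triP mu)).1 mulr1 big_seq_cond big1.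
    by rewrite addr0.
  move=> nu /andP[nuL numu]; rewrite part_coefZ.
  have [->|/(unitriangular_part_coef (triP nu)).2[e|d]] := eqVneq (part_coef (P nu) mu) 0.
  - exact: mulr0.
  - by rewrite e eqxx in numu.
  rewrite IH ?mul0r //; first exact: bad_up d bmu.
  by have := dom_lt_weight d; lia.
have a_0 mu : mu \in bounded_parts M -> mu <> la -> a mu = 0.
  move=> muL mula; have [bmu|nbmu] := pselect (bad mu).
    by apply: (abad (\max_(nu <- bounded_parts M) weight nu).+1 mu muL bmu); lia.
  have := dot0 mu mula nbmu; rewrite fa jack_dot_suml (bigD1_seq mu) //=.
  rewrite jack_dotZl big1 ?addr0 => [|nu /eqP numu]; last first.
    by rewrite jack_dotZl hP.1 ?mulr0.
  by move/eqP; rewrite mulf_eq0 (negbTE (jack_norm_neq0 mu)) orbF => /eqP.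
have [laL|laL] := boolP (la \in bounded_parts M).
  have f_a : f = a la *: P la.
    rewrite {1}fa (bigD1_seq la) //= big_seq_cond big1 ?addr0 //.
    by move=> mu /andP[muL /eqP mula]; rewrite a_0 ?scale0r.
  by rewrite {2}f_a part_coefZ (unitriangular_part_coef (triP la)).1 mulr1.
have f0 : f = 0.
  rewrite fa big_seq big1 // => mu muL; rewrite a_0 ?scale0r // => e.
  by rewrite -e muL in laL.
by rewrite f0 part_coef0 scale0r.
Qed.

End Jack.

(** * The Hankel hyperdeterminant is a Jack polynomial *)

Section ElementaryProducts.
Context (F : numFieldType) (Y : choiceType).
Implicit Types (u v : {cmonom Y}).

Lemma elementary_neq0 r u : elementary F Y r u != 0 ->
  mdeg u = r /\ forall y, (u y <= 1)%N.
Proof.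
rewrite elementaryE; case: (mdeg u =P r) => [->|] /=; last by rewrite eqxx.
by case: sqfreeP => //; rewrite eqxx.
Qed.

(** A product of [n] squarefree monomials has exponents at most [n]. *)
Lemma elementary_prod_neq0 n (a : 'I_n -> nat) u :
    (\prod_i elementary F Y (a i)) u != 0 ->
  mdeg u = (\sum_i a i)%N /\ forall y, (u y <= n)%N.
Proof.
elim: n a u => [|n IH] a u.
  rewrite !big_ord0 series_coef1; case: (u =P mone) => [->|_]; last by rewrite eqxx.
  by move=> _; split; [rewrite mdeg1|move=> y; rewrite cm1].
rewrite !big_ord_recl => /series_coefM_neq0[v [w [<- /elementary_neq0[dv v1] /IH[dw w1]]]].
by split=> [|y]; rewrite ?mdegM ?dv ?dw // cmM -add1n leq_add.
Qed.

(** The only way to write [v ^ n] as a product of [n] squarefree monomials is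
    to take them all equal to [v]. *)
Lemma elementary_prod_pow v n (a : 'I_n -> nat) : sqfree v ->
  (\prod_i elementary F Y (a i)) (expcmn v n) =
    [forall i, a i == mdeg v]%:R.
Proof.
move=> sv; have v1 := sqfreeP _ sv; elim: n a => [|n IH] a.
  rewrite big_ord0 series_coef1 eqxx (introT forallP) //.
  by case.
have vdiv : divcm (expcmn v n.+1) v = expcmn v n.
  by apply/eqP/cmP=> y; rewrite divcmE !expcmnE mulSn addKn.
have vd : v \in divisors (expcmn v n.+1).
  by apply: divisorsE => y; rewrite expcmnE mulSn leq_addr.
rewrite big_ord_recl series_coefM (big_fsetD1 v vd) vdiv IH.
rewrite big_seq big1 => [|d]; last first.
  rewrite !inE => /andP[dv ddiv]; apply/eqP; rewrite mulf_eq0; apply: contraT.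
  rewrite negb_or => /andP[/elementary_neq0[_ d1] /elementary_prod_neq0[_ w1]].
  case/eqP: dv; apply/eqP/cmP=> y.
  have e : (d y + divcm (expcmn v n.+1) d y = n.+1 * v y)%N.
    by rewrite -cmM mulcm_div // expcmnE.
  have := w1 y; have := d1 y; have := v1 y; move: e.
  set w := divcm _ _ y; case: (v y) => [|[|//]]; first by rewrite muln0; lia.
  by rewrite muln1; lia.
rewrite elementaryE sv andbT; apply: etrans (addr0 _) _.
rewrite -natrM mulnb; have -> // : (mdeg v == a ord0) && [forall i, a (lift ord0 i) == mdeg v]
  = [forall i, a i == mdeg v].
apply/andP/forallP=> [[/eqP a0 /forallP h] i|h].
  by case: (unliftP ord0 i) => [j ->|->]; rewrite ?h // a0.
by split; [rewrite eq_sym h|apply/forallP=> i].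
Qed.

End ElementaryProducts.

Section Conclusion.
Context (F : numFieldType) (n k : nat).
Hypotheses (n0 : (0 < n)%N).
Let m := (k * (n - 1))%N.
Local Notation H := (hankel_sym F n k).
Local Notation perms := {ffun 'I_(2 * k) -> 'S_n}.

Lemma hankel_part_coef mu : part_coef H mu = n`!%:R^-1 *
  \sum_(s : perms) perms_sign F s *
    (\prod_i elementary F nat (\sum_j s j i)%N) (mon_of mu).
Proof.
rewrite /part_coef sym_evalE ev_hankel_sym series_coefZ series_coef_sum.
congr (_ * _); apply: eq_bigr => s _; rewrite series_coefZ; congr (_ * _).
by under eq_bigr do rewrite ev_esf_elementary.
Qed.

Lemma double_bin2 : (2 * 'C(n, 2) = n * (n - 1))%N.
Proof.
have even_prod : ~~ odd (n * n.-1).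
  by rewrite oddM; case: (n) => // n' /=; case: odd.
by rewrite bin2 mul2n even_halfK // subn1.
Qed.

Lemma sum_perms (s : perms) : (\sum_i \sum_j s j i = m * n)%N.
Proof.
rewrite exchange_big /= (eq_bigr (fun=> 'C(n, 2))) => [|j _]; last first.
  rewrite -bin2_sum big_mkord.
  by rewrite [RHS](reindex_inj (@perm_inj _ (s j))).
rewrite sum_nat_const card_ord /m (mulnC 2) -mulnA double_bin2.
by rewrite -mulnA (mulnC n).
Qed.

Lemma hankel_part_coef_neq0 mu : part_coef H mu != 0 ->
  sumn mu = (m * n)%N /\ (head 0 mu <= n)%N.
Proof.
rewrite hankel_part_coef mulf_eq0 negb_or => /andP[_ h].
have [/existsP[s sn]|/existsPn no] := boolP [exists s : perms,
    (\prod_i elementary F nat (\sum_j s j i)%N) (mon_of mu) != 0].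
  have [ds hs] := elementary_prod_neq0 sn.
  by rewrite -mdeg_mon_of ds sum_perms; split=> //; rewrite -nth0 -mon_ofE.
move: h; rewrite big1 ?eqxx // => s _.
by have := no s; rewrite negbK => /eqP->; rewrite mulr0.
Qed.

Lemma is_part_ones j : is_part (nseq j 1%N).
Proof. by apply/andP; split; [elim: j => // -[|j]|rewrite mem_nseq andbF]. Qed.

Definition ones : intpart := IntPart (is_part_ones m).

Lemma mon_of_rect : mon_of (rect_part n k) = expcmn (mon_of ones) n.
Proof.
apply/eqP/cmP=> z; rewrite expcmnE !mon_ofE !nth_nseq -/m.
by case: ltnP; rewrite ?muln1 ?muln0.
Qed.

Lemma vandermonde_power_coef :
  (vandermonde (fun i : 'I_n => xmon F (ucm i)) ^+ (2 * k)) (cm_of (fun=> m)) =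
  (-1) ^+ ('C(n, 2) * k) * ((k * n)`!%:R / k`!%:R ^+ n).
Proof.
rewrite vandermonde_node_powers series_coefZ; congr (_ * _).
have := dyson_coef F [set: 'I_n] (fun=> k).
have -> : dyson_exp [set: 'I_n] (fun=> k) = cm_of (fun=> m).
  apply: cm_of_eqfun => i; rewrite inE sum_nat_const cardsT card_ord /m.
  by rewrite mulnBr muln1 mulnC.
have -> : multinomial F [set: 'I_n] (fun=> k) = (k * n)`!%:R / k`!%:R ^+ n.
  by rewrite /multinomial sum_nat_const prodr_const cardsT card_ord mulnC.
move=> <-; congr (scoef _ _); rewrite /dyson /node_powers [RHS]big_mkcond.
apply: eq_bigr => i _; rewrite inE; congr (_ ^+ _).
by apply: eq_bigl => j; rewrite inE.
Qed.

(** Only the terms whose exponents are all equal to [k (n - 1)] contribute, so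
    that Dyson's identity gives the coefficient. *)
Lemma hankel_part_coef_rect : part_coef H (rect_part n k) =
  (-1) ^+ (k * n * (n - 1) %/ 2) / n`!%:R * ((k * n)`!%:R / k`!%:R ^+ n).
Proof.
have -> : (k * n * (n - 1) %/ 2 = 'C(n, 2) * k)%N.
  by rewrite -mulnA -double_bin2 mulnC -mulnA mulKn.
rewrite [_ / n`!%:R]mulrC -mulrA -vandermonde_power_coef vandermonde_power hankel_part_coef.
congr (_ * _); rewrite series_coef_sum; apply: eq_bigr => s _.
rewrite series_coefZ mon_of_rect; congr (_ * _).
rewrite elementary_prod_pow; last first.
  by apply/sqfreeP=> y; rewrite mon_ofE nth_nseq; case: ifP.
rewrite mdeg_mon_of sumn_nseq mul1n /=.
have -> // : [forall i, (\sum_j s j i)%N == m] = (cm_of (fun=> m) == perms_exp s).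
apply/forallP/eqP=> [h|/cm_ofP h i].
  by apply: cm_of_eqfun => i; apply/esym/eqP.
by have := h i; rewrite cm_ofE => /esym/eqP.
Qed.

(** The hyperdeterminant is homogeneous and its letters have exponents at most
    [n]: this excludes the partitions of another size or with a larger part.  The
    remaining ones, apart from the rectangle, have more than [k (n - 1)] parts,
    so that their Jack polynomials vanish on [k (n - 1)] letters and are
    orthogonal to the hyperdeterminant. *)
Lemma hankel_jack (P : intpart -> symfun F) : (0 < k)%N -> is_jack k%:R P ->
  H = part_coef H (rect_part n k) *: P (rect_part n k).
Proof.
move=> k0 hP; apply: (jack_characterization (alpha := k%:R) _ hP
  (bad := fun mu => sumn mu <> (m * n)%N \/ (n < head 0 mu)%N)).
- by rewrite pnatr_eq0 -lt0n.
- move=> mu nu d [sm|hm]; first by left; rewrite -(dom_lt_sumn d).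
  by right; apply: leq_trans hm (dom_lt_head d).
- move=> mu b; apply/eqP; apply: contraT => /hankel_part_coef_neq0[sm hm].
  by case: b => // lt; rewrite ltnNge hm in lt.
- move=> mu ne nb; apply: jack_dot_hankel_vanish => //.
  apply: (unitriangular_vanish (hP.2 mu)); rewrite ltnNge; apply/negP=> sz.
  case: ne; apply: val_inj; apply: rectP => //.
    by apply: contrapT => sm; apply: nb; left.
  by rewrite leqNgt; apply/negP=> hd; apply: nb; right.
case=> [|]; first by rewrite /= sumn_nseq mulnC.
by rewrite /=; case: (k * _)%N => //= ?; rewrite ltnn.
Qed.

End Conclusion.

Theorem corollary3p3 (F : numFieldType) (Y : choiceType) (n k : nat)
    (hn : (1 <= n)%N) (hk : (1 <= k)%N)
    (P : intpart -> symfun F) (hP : is_jack k%:R P) :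
  hankel_hyperdet F Y n k =
    ((-1) ^+ (k * n * (n - 1) %/ 2) / n`!%:R
      * ((k * n)`!%:R / k`!%:R ^+ n)) *: sym_eval Y (P (rect_part n k)).
Proof.
rewrite -hankel_part_coef_rect -sym_eval_hankel !sym_evalE -evZ.
by rewrite -hankel_jack.
Qed.
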